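(* Let $n>m\geq 2$ be two integers. Then: (1) $\operatorname{sdepth}(J_{n,m})\geq \min\{\varphi(n-1,m)+m-1,\;\varphi(n,m)+1\}$. (2) $\operatorname{sdepth}(J_{n,m})\geq \operatorname{depth}(J_{n,m})=\varphi(n-1,m)+1$. (3) If $m\geq 3$, then $\operatorname{sdepth}(J_{n,m})\geq \varphi(n,m)+1$, so $\operatorname{sdepth}(J_{n,m})\geq \operatorname{sdepth}(S/J_{n,m})+1$.
   Context: $K$ is a field and $S=K[x_1,\ldots,x_n]$. The $m$-path ideal of the path graph with $n$ vertices is $$I_{n,m}=(x_1x_2\cdots x_m,\;x_2x_3\cdots x_{m+1},\;\ldots,\;x_{n-m+1}\cdots x_n)\subset S,$$ and the $m$-path ideal of the cycle graph with $n$ vertices is $$J_{n,m}=I_{n,m}+(x_{n-m+2}\cdots x_nx_1,\;\ldots,\;x_nx_1\cdots x_{m-1})\subset S,$$ i.e. the ideal generated by all products of $m$ cyclically consecutive variables. For integers $N\geq m\geq 1$, $$\varphi(N,m):=N+1-\left\lfloor \frac{N+1}{m+1}\right\rfloor-\left\lceil \frac{N+1}{m+1}\right\rceil.$$ For a $\mathbb Z^n$-graded $S$-module $M$, a Stanley decomposition of $M$ is a direct sum $\mathcal D:\ M=\bigoplus_{i=1}^r m_iK[Z_i]$ of $\mathbb Z^n$-graded $K$-vector spaces, where each $m_i\in M$ is homogeneous with respect to the $\mathbb Z^n$-grading, $Z_i\subset\{x_1,\ldots,x_n\}$, and $m_iK[Z_i]=\{um_i : u\in K[Z_i]\}\subset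 M$ is a free $K[Z_i]$-submodule of $M$. One sets $\operatorname{sdepth}(\mathcal D)=\min_{i}|Z_i|$ and the Stanley depth is $\operatorname{sdepth}(M)=\max\{\operatorname{sdepth}(\mathcal D) : \mathcal D \text{ a Stanley decomposition of } M\}$. $\operatorname{depth}$ is the usual depth of a graded $S$-module (with respect to $(x_1,\ldots,x_n)$). *)

(* Defs.v *)
From HB Require Import structures.
From mathcomp Require Import all_boot all_algebra.
From mathcomp Require Import mpoly.
From mathcomp Require Import boolp.

Set Implicit Arguments.
Unset Strict Implicit.
Unset Printing Implicit Defensive.

Import GRing.Theory.
Local Open Scope ring_scope.
Local Open Scope quotient_scope.

(* The maximum of a set of natural numbers, with value 0 for a set that has
   no maximum. *)
Definition natmax (P : nat -> Prop) : nat :=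
  if pselect (exists d, P d /\ forall e, P e -> (e <= d)%N) is left ex
  then sval (cid ex) else 0%N.

(* The second quotient, with its correction term, is the ceiling of
   (N + 1) / (m + 1). No subtraction is truncated when m >= 1. *)
Definition phi (N m : nat) : nat :=
  (N + 1 - (N + 1) %/ (m + 1)
   - ((N + 1) %/ (m + 1) + ~~ (m + 1 %| N + 1)))%N.

Section Ideals.
Variables (R : comNzRingType) (r : nat) (g : 'I_r -> R).

Definition ideal_gen : {pred R^o} :=
  fun f : R => `[< exists c : 'I_r -> R, f = \sum_i c i * g i >].

Lemma ideal_genP (f : R) :
  reflect (exists c : 'I_r -> R, f = \sum_i c i * g i) (f \in ideal_gen).
Proof. exact: asboolP. Qed.

Lemma ideal_gen_submod : submod_closed ideal_gen.
Proof.
split.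
  by apply/ideal_genP; exists (fun=> 0); rewrite big1 // => i; rewrite mul0r.
move=> a x y /ideal_genP[c ->] /ideal_genP[d ->].
apply/ideal_genP; exists (fun i => a * c i + d i).
rewrite /GRing.scale /= mulr_sumr -big_split; apply: eq_bigr => i _ /=.
by rewrite mulrDl mulrA.
Qed.

HB.instance Definition _ :=
  GRing.isSubmodClosed.Build R R^o ideal_gen ideal_gen_submod.

Definition ideal_mod : Type := {f : R^o | f \in ideal_gen}.
HB.instance Definition _ := SubChoice.on ideal_mod.
HB.instance Definition _ := [SubChoice_isSubLmodule of ideal_mod by <:].

Definition quot_mod : Type := {ideal_quot ideal_gen}.
HB.instance Definition _ := GRing.Zmodule.on quot_mod.

Definition quot_pi (f : R) : quot_mod := \pi_{ideal_quot ideal_gen} f.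

Lemma quot_pi_is_zmod_morphism : zmod_morphism quot_pi.
Proof. exact: (raddfB (\pi_{ideal_quot ideal_gen})). Qed.
HB.instance Definition _ := GRing.isZmodMorphism.Build R quot_mod
  quot_pi quot_pi_is_zmod_morphism.

Lemma quot_piP f h : quot_pi f = quot_pi h <-> f - h \in ideal_gen.
Proof.
by rewrite Quotient.idealrBE; split=> [e|/eqP]; [apply/eqP|].
Qed.

Lemma quot_piK (x : quot_mod) : quot_pi (repr x) = x.
Proof. exact: reprK. Qed.

Definition quot_scale (a : R) (x : quot_mod) : quot_mod :=
  quot_pi (a * repr x).

Lemma quot_scale_pi a f : quot_scale a (quot_pi f) = quot_pi (a * f).
Proof.
apply/quot_piP; rewrite -mulrBr; apply: (rpredZ (V := R^o) a).
by apply/quot_piP; rewrite quot_piK.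
Qed.

Lemma quot_scaleA a b x : quot_scale a (quot_scale b x) = quot_scale (a * b) x.
Proof. by rewrite -(quot_piK x) !quot_scale_pi mulrA. Qed.

Lemma quot_scale1 : left_id 1 quot_scale.
Proof. by move=> x; rewrite -(quot_piK x) quot_scale_pi mul1r. Qed.

Lemma quot_scaleDr : right_distributive quot_scale +%R.
Proof.
move=> a x y; rewrite -(quot_piK x) -(quot_piK y) -raddfD !quot_scale_pi.
by rewrite mulrDr raddfD.
Qed.

Lemma quot_scaleDl x : {morph quot_scale^~ x : a b / a + b}.
Proof.
by move=> a b; rewrite -(quot_piK x) !quot_scale_pi mulrDl raddfD.
Qed.

HB.instance Definition _ := GRing.Zmodule_isLmodule.Build R quot_mod
  quot_scaleA quot_scale1 quot_scaleDr quot_scaleDl.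

Lemma quot_piZ a f : quot_pi (a * f) = a *: quot_pi f.
Proof. by rewrite -quot_scale_pi. Qed.
End Ideals.

Section Depth.
Variables (R : comNzRingType) (M : lmodType R).

(* The submodule (s_0, ..., s_{k-1}) M. *)
Definition seq_submod (s : seq R) (x : M) : Prop :=
  exists y : nat -> M, x = \sum_(i < size s) s`_i *: y i.

Definition regular_seq (s : seq R) : Prop :=
  (forall i, (i < size s)%N -> forall x : M,
     seq_submod (take i s) (s`_i *: x) -> seq_submod (take i s) x)
  /\ exists x : M, ~ seq_submod s x.

Definition depth (I : {pred R}) : nat :=
  natmax (fun d => exists s : seq R,
    [/\ size s = d, {subset s <= I} & regular_seq s]).
End Depth.
Arguments depth {R} M I.

Section StanleyDepth.
Variables (n : nat) (K : fieldType).
Local Notation S := {mpoly K[n]}.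
Local Notation degree := {ffun 'I_n -> int}.

(* S_a: the multiples of the monomial of exponent a, or 0 if a has a negative
   coordinate. *)
Definition mpoly_comp (a : degree) (f : S) : Prop :=
  forall u, u \in msupp f -> forall i, (u i)%:Z = a i.

(* A Z^n-grading of M: M is the direct sum of the M_a, and S_a M_b lies in
   M_(a+b). *)
Record grading (M : lmodType S) := Grading {
  gr_comp : degree -> M -> Prop;
  gr_comp0 : forall a, gr_comp a 0;
  gr_compB : forall a x y, gr_comp a x -> gr_comp a y -> gr_comp a (x - y);
  gr_compZ : forall a b f x,
    mpoly_comp a f -> gr_comp b x -> gr_comp (a + b) (f *: x);
  gr_comp_span : forall x, exists (A : seq degree) (y : degree -> M),
    [/\ uniq A, forall a, gr_comp a (y a) & x = \sum_(a <- A) y a];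
  gr_comp_free : forall (A : seq degree) (y : degree -> M),
    uniq A -> (forall a, gr_comp a (y a)) -> \sum_(a <- A) y a = 0 ->
    {in A, forall a, y a = 0}
}.

(* K[Z] *)
Definition mpoly_on (Z : {set 'I_n}) (f : S) : Prop :=
  forall u, u \in msupp f -> forall i, i \notin Z -> u i = 0%N.

Section Module.
Variables (M : lmodType S) (G : grading M).

Definition stanley_space (x : M) (Z : {set 'I_n}) (y : M) : Prop :=
  exists2 u : S, mpoly_on Z u & y = u *: x.

(* The directness of the sum is the uniqueness of the components; every
   summand is a graded subspace because its generator is homogeneous. *)
Definition stanley_decomposition (r : nat) (x : 'I_r -> M)
    (Z : 'I_r -> {set 'I_n}) : Prop :=
  [/\ forall i, exists a, gr_comp G a (x i),
      forall i u, mpoly_on (Z i) u -> u *: x i = 0 -> u = 0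
    & forall y : M, exists! v : {ffun 'I_r -> M},
        (forall i, stanley_space (x i) (Z i) (v i)) /\ y = \sum_i v i].

(* The neutral element n only matters for r = 0, as #|Z i| <= n. *)
Definition stanley_min (r : nat) (Z : 'I_r -> {set 'I_n}) : nat :=
  \big[minn/n]_(i < r) #|Z i|.

Definition sdepth : nat :=
  natmax (fun d => exists (r : nat) (x : 'I_r -> M) (Z : 'I_r -> {set 'I_n}),
    stanley_decomposition x Z /\ stanley_min Z = d).
End Module.

Definition mdegree (u : 'X_{1..n}) : degree := [ffun i => (u i)%:Z].

Lemma mdegree_inj : injective mdegree.
Proof.
by move=> u v /ffunP e; apply/mnmP => i; have := e i; rewrite !ffunE => -[].
Qed.

Lemma mpoly_compP a f :
  mpoly_comp a f <-> forall u, u \in msupp f -> mdegree u = a.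
Proof.
split=> h u /h e; first by apply/ffunP => i; rewrite ffunE.
by move=> i; rewrite -e ffunE.
Qed.

(* The homogeneous component of degree a of a polynomial. *)
Definition mpoly_part (a : degree) (f : S) : S :=
  let u := [multinom absz (a i) | i < n] in
  if mdegree u == a then f@_u *: 'X_[u] else 0.

Lemma mpoly_part_is_zmod_morphism a : zmod_morphism (mpoly_part a).
Proof.
move=> f h; rewrite /mpoly_part; case: ifP => _; last by rewrite subr0.
by rewrite mcoeffB scalerBl.
Qed.
HB.instance Definition _ a := GRing.isZmodMorphism.Build S S
  (mpoly_part a) (mpoly_part_is_zmod_morphism a).

Lemma mpoly_partX a c u :
  mpoly_part a (c *: 'X_[u]) = if mdegree u == a then c *: 'X_[u] else 0.
Proof.
rewrite /mpoly_part; set v := [multinom _ | _ < _].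
have vE : mdegree u = a -> v = u.
  by move=> e; apply/mnmP => i; rewrite mnmE -e ffunE.
rewrite mcoeffZ mcoeffX.
have [ua|nua] := eqVneq (mdegree u) a.
  by rewrite (vE ua) ua !eqxx mulr1.
case: eqP => // va; rewrite [u == v](_ : _ = false) ?mulr0 ?scale0r //.
by apply: contraNF nua => /eqP ->; rewrite va.
Qed.

Lemma mpoly_partE a f :
  mpoly_part a f = \sum_(u <- msupp f | mdegree u == a) f@_u *: 'X_[u].
Proof.
rewrite {1}[f]mpolyE raddf_sum [RHS]big_mkcond.
by apply: eq_bigr => u _; apply: mpoly_partX.
Qed.

Lemma mpoly_comp_part a f : mpoly_comp a (mpoly_part a f).
Proof.
apply/mpoly_compP => u; rewrite /mpoly_part; case: ifP => [/eqP va|_];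
  last by rewrite msupp0.
by move/msuppZ_le; rewrite msuppX inE => /eqP ->.
Qed.

Lemma mpoly_part_comp a b f :
  mpoly_comp b f -> mpoly_part a f = if a == b then f else 0.
Proof.
move/mpoly_compP=> h; rewrite mpoly_partE.
case: eqVneq => [->|nab]; last first.
  rewrite big_seq_cond big1 // => u /andP[/h -> /eqP e].
  by rewrite e eqxx in nab.
rewrite {3}[f]mpolyE [LHS]big_seq_cond [RHS]big_seq; apply: eq_bigl => u.
by case: (boolP (u \in _)) => // /h ->; rewrite eqxx.
Qed.

Lemma mpoly_comp0 a : mpoly_comp a 0.
Proof. by move=> u; rewrite msupp0. Qed.

Lemma mpoly_compB a f h :
  mpoly_comp a f -> mpoly_comp a h -> mpoly_comp a (f - h).
Proof.
move=> /(mpoly_part_comp a) + /(mpoly_part_comp a); rewrite eqxx => <- <-.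
by rewrite -raddfB; apply: mpoly_comp_part.
Qed.

Lemma mpoly_compM a b f h :
  mpoly_comp a f -> mpoly_comp b h -> mpoly_comp (a + b) (f * h).
Proof.
move=> /mpoly_compP hf /mpoly_compP hh; apply/mpoly_compP => u.
move/msuppM_le/allpairsP=> [[v w] /= [/hf <- /hh <- ->]].
by apply/ffunP => i; rewrite !ffunE mnmDE PoszD.
Qed.

Lemma mpoly_part_sum (f : S) :
  f = \sum_(a <- map mdegree (msupp f)) mpoly_part a f.
Proof.
rewrite big_map {1}[f]mpolyE [LHS]big_seq [RHS]big_seq.
apply: eq_bigr => u uf; rewrite mpoly_partE -big_filter.
rewrite (_ : [seq _ <- _ | _] = [:: u]) ?big_seq1 //.
rewrite (eq_filter (a2 := pred1 u)); first exact: filter_pred1_uniq (msupp_uniq f) uf.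
by move=> v; rewrite (inj_eq mdegree_inj).
Qed.

Lemma uniq_mdegree (f : S) : uniq (map mdegree (msupp f)).
Proof. by rewrite (map_inj_uniq mdegree_inj) msupp_uniq. Qed.

Lemma mpoly_part_free (A : seq degree) (y : degree -> S) a :
  uniq A -> (forall b, mpoly_comp b (y b)) -> a \in A ->
  mpoly_part a (\sum_(b <- A) y b) = y a.
Proof.
move=> uA yA aA; rewrite raddf_sum (bigD1_seq a) //= (mpoly_part_comp a (yA a)) eqxx.
rewrite big1 ?addr0 // => b; rewrite eq_sym => nba.
by rewrite (mpoly_part_comp _ (yA b)) (negbTE nba).
Qed.

Section MonomialIdeal.
Variables (r : nat) (w : 'I_r -> 'X_{1..n}).
Local Notation g := (fun i => 'X_[K, w i]).
Local Notation I := (ideal_gen g).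

Lemma mpoly_part_ideal a (f : S) : f \in I -> mpoly_part a f \in I.
Proof.
move/ideal_genP => [c ->]; rewrite raddf_sum.
apply: rpred_sum => i _; rewrite {1}[c i]mpolyE mulr_suml raddf_sum.
apply: rpred_sum => u _; rewrite -scalerAl -mpolyXD [X in X \in _]mpoly_partX.
case: ifP => _; last exact: rpred0.
rewrite mpolyXD scalerAl; apply: (rpredZ (V := S^o)).
apply/ideal_genP; exists (fun j => (j == i)%:R).
by rewrite (bigD1 i) //= eqxx mul1r big1 ?addr0 // => j /negbTE ->; rewrite mul0r.
Qed.

Definition ideal_comp (a : degree) (x : ideal_mod g) : Prop :=
  mpoly_comp a (val x).

Definition quot_comp (a : degree) (x : quot_mod g) : Prop :=
  exists2 f : S, mpoly_comp a f & x = quot_pi g f.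

Definition ideal_part (a : degree) (x : ideal_mod g) : ideal_mod g :=
  Sub (mpoly_part a (val x)) (mpoly_part_ideal a (valP x)).

Definition ideal_grading : grading (ideal_mod g).
Proof.
apply: (@Grading _ ideal_comp).
- move=> a; exact: mpoly_comp0.
- move=> a x y; exact: mpoly_compB.
- move=> a b f x; exact: mpoly_compM.
- move=> x; exists (map mdegree (msupp (val x : S))), (ideal_part^~ x).
  split; [exact: uniq_mdegree | by move=> a; apply: mpoly_comp_part |].
  apply: val_inj; rewrite (raddf_sum (val : ideal_mod g -> S^o)) /=.
  exact: mpoly_part_sum.
- move=> A y uA yA e a aA; apply: val_inj => /=.
  rewrite -(mpoly_part_free uA yA aA).
  have /= := raddf_sum (val : ideal_mod g -> S^o) A xpredT y.
  by rewrite e /= => <-; rewrite raddf0.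
Defined.

Definition quot_grading : grading (quot_mod g).
Proof.
apply: (@Grading _ quot_comp).
- by move=> a; exists 0; [exact: mpoly_comp0 | rewrite raddf0].
- move=> a _ _ [f fa ->] [h ha ->]; exists (f - h); last by rewrite raddfB.
  exact: mpoly_compB.
- move=> a b f _ fa [h hb ->]; exists (f * h); last by rewrite quot_piZ.
  exact: mpoly_compM.
- move=> x; rewrite -(quot_piK x); set f := repr x.
  exists (map mdegree (msupp (f : S))), (fun a => quot_pi g (mpoly_part a f)).
  split; first exact: uniq_mdegree.
    by move=> a; exists (mpoly_part a f); first exact: mpoly_comp_part.
  by rewrite -raddf_sum -mpoly_part_sum.
- move=> A y uA yA; pose f a := s2val (cid2 (yA a)).
  have fA a : mpoly_comp a (f a) by rewrite /f; case: cid2.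
  have yE a : y a = quot_pi g (f a) by rewrite /f; case: cid2.
  rewrite (eq_bigr _ (fun a _ => yE a)) -raddf_sum => e a aA.
  rewrite yE -(raddf0 (quot_pi g)); apply/quot_piP; rewrite subr0.
  rewrite -(mpoly_part_free uA fA aA); apply: mpoly_part_ideal.
  by rewrite -[X in X \in _]subr0; apply/quot_piP; rewrite e raddf0.
Defined.

End MonomialIdeal.
End StanleyDepth.

Definition max_ideal (n : nat) (K : fieldType) : {pred {mpoly K[n]}} :=
  ideal_gen (fun i : 'I_n => 'X_i : {mpoly K[n]}).

Arguments max_ideal n K : clear implicits.

(* The exponent vector of x_i x_(i+1) ... x_(i+m-1), with indices modulo n. *)
Definition cycle_path_exp (n m : nat) (i : 'I_n) : 'X_{1..n} :=
  (\sum_(k < m) U_(iter k (@ordS n) i))%MM.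
Arguments cycle_path_exp n m i : clear implicits.

Lemma cycle_path_prod (K : fieldType) (n m : nat) (i : 'I_n) :
  'X_[K, cycle_path_exp n m i] = \prod_(k < m) 'X_(iter k (@ordS n) i).
Proof. by rewrite mprodXE. Qed.

(* Main.v *)
(* Write f(x) for the floor plus the ceiling of x / (m + 1), so that
   phi N m = N + 1 - f(N + 1). A squarefree monomial is a set of vertices, and
   J consists of the sets that contain m cyclically consecutive vertices (a run).

   Stanley depth of J: a set other than the full one has a first vertex i such
   that i - 1 is missing and a run starts at i. For each i, the remaining
   vertices are read by a decision tree that leaves a short initial segment
   free, the length of which depends on the residue of the number of vertices
   modulo m + 1; it cuts the sets with first vertex i into Boolean intervals
   whose tops miss at most f(n + 1) - 2 vertices. Each interval is a summand of
   a Stanley decomposition. A facet of the complement with phi n m elements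
   bounds sdepth(S/J) from above.

   Depth of J, lower bound: a decision tree for the complement of J with at most
   f(n) missing vertices at each leaf shows, by induction along the exact
   sequences of (I : x) and (I, x), that the elementary symmetric polynomials
   e_1, ..., e_(n - f(n)) are regular on S/J, whence e_1, ..., e_(n - f(n) + 1)
   are regular on J. Upper bound: a Koszul cocycle that is not a coboundary
   bounds the length of all regular sequences by its degree. Such a cocycle
   comes from the simplicial complex of run-free sets: along another decision
   tree all branches but those of one dimension are cones, so its cohomology is
   concentrated in one degree and is not zero there. *)
Require Import Defs.
From mathcomp Require Import all_boot all_algebra.
From mathcomp Require Import mpoly.
From mathcomp Require Import boolp zify.

Set Implicit Arguments.
Unset Strict Implicit.
Unset Printing Implicit Defensive.

Import GRing.Theory.

(** * Sets without runs *)

(** A missing vertex that is read too early costs one without lowering [f] of the number of vertices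
    still to be read. The trees therefore skip a few vertices, as many as the residue demands, and
    look for a missing vertex in the window that follows. One found there lowers [f] by 1, and the
    skipped vertices stay free because no forbidden run fits before it. If the window is full, the
    skipped vertices are read backwards; a missing one among them forces, unless the block ends, a
    second one at most [m] places further on, and the pair is paid for by [f (x + m.+1) = f x + 2].
    The bound f(n + 1) - 2 equals f(n - m): a run and its missing predecessor are fixed, and at most
    n - m - 1 vertices have to be read. Elementary symmetric polynomials are used because one
    sequence has to be regular at all leaves at once, and e_j restricted to a coordinate subspace is
    again e_j. This works over every field, whereas general linear forms call for an infinite
    one. *)

Ltac arith := repeat match goal with
  | H : forall _, _ |- _ => clear H
  | H : context [in_mem] |- _ => clear H
  | H : context [subset] |- _ => clear H
  end; lia.

(** * The sum of the floor and the ceiling of x / (m + 1) *)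

Section PathZeros.
Variable m : nat.

Definition path_zeros x := (x %/ m.+1).*2 + (0 < x %% m.+1).
Local Notation f := path_zeros.

Lemma path_zerosE q s : s <= m -> f (q * m.+1 + s) = q.*2 + (0 < s).
Proof.
by move=> sm; rewrite /f divnMDl // modnMDl divn_small ?modn_small // addn0.
Qed.

Lemma path_zerosP x :
  exists q s, [/\ s <= m, x = q * m.+1 + s & f x = q.*2 + (0 < s)].
Proof.
exists (x %/ m.+1), (x %% m.+1); split=> //; last exact: divn_eq.
by rewrite -ltnS ltn_mod.
Qed.

Lemma path_zeros_mono x y : x <= y -> f x <= f y.
Proof.
have [q [s [sm -> ->]]] := path_zerosP x.
have [q' [s' [sm' -> ->]]] := path_zerosP y => le.
have [lt|] := ltnP q q'; first by case: (0 < s); lia.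
rewrite leq_eqVlt => /orP[/eqP eq|lt].
  by subst q'; case: (posnP s); case: (posnP s'); lia.
have : q' * m.+1 + m.+1 <= q * m.+1 by rewrite -mulSnr leq_mul2r lt orbT.
lia.
Qed.

Lemma path_zerosD x : f (x + m.+1) = f x + 2.
Proof.
have [q [s [sm -> ->]]] := path_zerosP x.
by rewrite addnAC -mulSnr path_zerosE // doubleS addnC; lia.
Qed.

Lemma path_zeros_gt0 x : 0 < x -> 0 < f x.
Proof.
have [q [s [sm -> ->]]] := path_zerosP x.
by case: s sm => [|s] sm; [case: q => [|q]; rewrite ?mul0n // doubleS | rewrite /= addn1].
Qed.

Lemma path_zerosS x : 0 < m -> f x.+1 <= (f x).+1.
Proof.
move=> m0; have [q [s [sm -> ->]]] := path_zerosP x; rewrite -addnS.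
have [lt|ge] := ltnP s m; first by rewrite path_zerosE //; case: s {sm} lt; arith.
have -> : q * m.+1 + s.+1 = q.+1 * m.+1 + 0 by rewrite mulSn; arith.
by rewrite path_zerosE // doubleS addn0 (leq_trans m0 ge) addn1.
Qed.

Lemma path_zeros_le x : 0 < m -> f x <= x.
Proof.
move=> m0; elim: x => [|x IH]; first by rewrite /f div0n mod0n.
exact: leq_trans (path_zerosS _ m0) _.
Qed.

(** The step is the residue of [x], or 1 if the residue is 0: the shortest one that lowers [f]. The
    decision trees derive from it the number of vertices they leave free. *)
Lemma path_zeros_drop x : 0 < m -> 0 < x ->
  exists s, [/\ 0 < s, s <= m, s <= x & f (x - s) < f x].
Proof.
move=> m0; have [q [[|s] [sm -> ->]]] := path_zerosP x; last first.
  exists s.+1; split=> //; first by rewrite leq_addl.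
  by rewrite addnK -[X in f X]addn0 path_zerosE // addn0 addn1.
case: q => [|q] // _; exists 1%N; split=> //.
have ->: q.+1 * m.+1 + 0 - 1 = q * m.+1 + m by rewrite mulSn; lia.
by rewrite path_zerosE // m0 /= doubleS; lia.
Qed.
End PathZeros.

(** * Decision trees and partitions into Boolean intervals *)

Section DecisionTree.
Variable T : finType.
Implicit Types (A B X : {set T}) (Q : pred {set T}).

(* Only the leaves inside [Q] are charged for the elements they miss. *)
Inductive dtree Q (z : nat) : {set T} -> {set T} -> Prop :=
| dt_leaf A B : A \subset B -> (forall X, A \subset X -> X \subset B -> Q X) ->
    #|~: B| <= z -> dtree Q z A B
| dt_dead A B : (forall X, A \subset X -> X \subset B -> ~~ Q X) -> dtree Q z A B
| dt_split k A B : k \notin A -> k \in B ->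
    dtree Q z (k |: A) B -> dtree Q z A (B :\ k) -> dtree Q z A B.

Definition interval A B X := (A \subset X) && (X \subset B).

(** The count says at once that the intervals are disjoint and that their union is [Q]. *)
Definition interval_partition Q (z : nat) := exists l : seq ({set T} * {set T}),
  (forall I, I \in l -> (I.1 \subset I.2) && (#|~: I.2| <= z)) /\
  forall X, count (fun I => interval I.1 I.2 X) l = Q X.

Lemma eq_interval_partition Q Q' z :
  Q =1 Q' -> interval_partition Q z -> interval_partition Q' z.
Proof. by move=> eQ [l [h c]]; exists l; split=> // X; rewrite c eQ. Qed.

Lemma interval_partition0 z : interval_partition (fun=> false) z.
Proof. by exists [::]. Qed.

Lemma interval_partition1 A B z : A \subset B -> #|~: B| <= z ->
  interval_partition (interval A B) z.
Proof.
move=> AB hz; exists [:: (A, B)]; split=> [I|X] /=; last by rewrite addn0.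
by rewrite inE => /eqP -> /=; rewrite AB.
Qed.

Lemma interval_partitionU Q Q1 Q2 z : (forall X, Q1 X + Q2 X = Q X :> nat) ->
  interval_partition Q1 z -> interval_partition Q2 z -> interval_partition Q z.
Proof.
move=> eQ [l1 [h1 c1]] [l2 [h2 c2]]; exists (l1 ++ l2); split=> [I|X].
  by rewrite mem_cat => /orP[/h1|/h2].
by rewrite count_cat c1 c2.
Qed.

Lemma interval_partition_sum n (Qi : 'I_n -> pred {set T}) Q z :
  (forall X, \sum_i Qi i X = Q X) ->
  (forall i, interval_partition (Qi i) z) -> interval_partition Q z.
Proof.
elim: n Qi Q => [|n IH] Qi Q eQ h.
  apply: (eq_interval_partition _ (interval_partition0 z)) => X.
  by have := eQ X; rewrite big_ord0; case: (Q X).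
pose Q' X := 0 < \sum_(i < n) Qi (lift ord0 i) X.
have eQ' X : \sum_(i < n) Qi (lift ord0 i) X = Q' X.
  have := eQ X; rewrite big_ord_recl /Q'.
  by case: (Q X); case: (Qi _ X); case: (\sum_(i < n) _) => [|[]].
apply: (interval_partitionU _ (h ord0) (IH (fun i => Qi (lift ord0 i)) Q' eQ' _)).
  by move=> X; rewrite -eQ' -eQ big_ord_recl.
by move=> i; apply: h.
Qed.

Lemma dtree_partition Q z A B : dtree Q z A B ->
  interval_partition (fun X => interval A B X && Q X) z.
Proof.
elim=> {A B} [A B AB hQ hz|A B hQ|k A B kA kB _ IH1 _ IH2].
- apply: eq_interval_partition (interval_partition1 AB hz) => X.
  by rewrite /interval; case: andP => // -[hA hB]; rewrite hQ.
- apply: eq_interval_partition (interval_partition0 z) => X.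
  rewrite /interval; case: andP => // -[/andP[hA hB] q].
  by rewrite (negbTE (hQ X hA hB)) in q.
apply: (interval_partitionU _ IH1 IH2) => X.
rewrite /interval subUset sub1set subsetD1.
by case: (k \in X); case: (A \subset X); case: (X \subset B); case: (Q X).
Qed.

Lemma cardsCD1 (B : {set T}) k : k \in B -> #|~: (B :\ k)| = #|~: B|.+1.
Proof.
by move=> kB; rewrite setCD setUC cardsU1 inE kB.
Qed.
End DecisionTree.

(** * Runs, blocks and reading a block *)

Section Runs.
Variables p m : nat.
Local Notation n := p.+1.
Local Notation f := (path_zeros m).
Implicit Types (A B X : {set 'I_n}) (Q : pred {set 'I_n}).

(* Residues are used as positions, so that runs may wrap around. *)
Definition pos k : 'I_n := inord (k %% n).

Lemma val_pos k : pos k = k %% n :> nat.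
Proof. by rewrite inordK // ltn_mod. Qed.

Lemma val_pos_small k : k < n -> pos k = k :> nat.
Proof. by move=> kn; rewrite val_pos modn_small. Qed.

Lemma pos_val (i : 'I_n) : pos i = i.
Proof. by apply: val_inj; rewrite /= val_pos_small. Qed.

Lemma posDn k : pos (k + n) = pos k.
Proof. by apply: val_inj; rewrite /= !val_pos modnDr. Qed.

Lemma pos_mod k : pos (k %% n) = pos k.
Proof. by apply: val_inj; rewrite /= !val_pos modn_mod. Qed.

Definition run X k L := all (fun i => pos i \in X) (iota k L).

Lemma runP X k L :
  reflect (forall i, k <= i < k + L -> pos i \in X) (run X k L).
Proof.
by apply: (iffP allP) => h i; [rewrite -mem_iota => /h | rewrite mem_iota => /h].
Qed.

Lemma run_addn X k L : run X (k + n) L = run X k L.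
Proof.
apply/runP/runP => h i hi; first by rewrite -posDn; apply: h; lia.
by rewrite -(subnK (_ : n <= i)) ?posDn; [apply: h|]; lia.
Qed.

Lemma run_mod X k L : run X (k %% n) L = run X k L.
Proof.
rewrite {2}(divn_eq k n) addnC; elim: (k %/ n) => [|q IH]; first by rewrite addn0.
by rewrite mulSnr addnA run_addn.
Qed.

Definition norun X o N :=
  all (fun j => (j + m <= o + N) ==> ~~ run X j m) (iota o N.+1).

Lemma norunP X o N :
  reflect (forall j, o <= j -> j + m <= o + N -> ~~ run X j m) (norun X o N).
Proof.
apply: (iffP allP) => h j.
  by move=> h1 h2; apply: (implyP (h j _)) => //; rewrite mem_iota; lia.
by rewrite mem_iota => hj; apply/implyP; apply: h; lia.
Qed.

(* The block counts as preceded by [h] present elements. *)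
Definition norun_after h X o N :=
  norun X o N && ~~ ((m - h <= N) && run X o (m - h)).

(* Unlike in [norun], the block may begin with a run of any length. *)
Definition norun_tail X o N :=
  all (fun j => (j.+1 + m <= o + N) ==> (run X j.+1 m ==> (pos j \in X)))
    (iota o N.+1).

Lemma norun_tailP X o N :
  reflect (forall j, o <= j -> j.+1 + m <= o + N -> run X j.+1 m -> pos j \in X)
    (norun_tail X o N).
Proof.
apply: (iffP allP) => h j.
  move=> h1 h2; apply: (implyP (implyP (h j _) h2)).
  by rewrite mem_iota; lia.
rewrite mem_iota => hj; apply/implyP => h1; apply/implyP => h2.
by apply: h; lia.
Qed.

Definition block o L : {set 'I_n} := [set i : 'I_n | o <= i < o + L].

Lemma block0 o : block o 0 = set0.
Proof. by apply/setP => i; rewrite !inE; lia. Qed.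

Lemma pos_block o L k : k < n -> (pos k \in block o L) = (o <= k < o + L).
Proof. by move=> kn; rewrite inE val_pos_small. Qed.

Lemma blockS o L : o + L < n -> block o L.+1 = pos (o + L) |: block o L.
Proof.
move=> h; apply/setP => i; rewrite !inE -val_eqE /= val_pos_small //; lia.
Qed.

Lemma block_Sl o L : o < n -> block o L.+1 = pos o |: block o.+1 L.
Proof.
move=> h; apply/setP => i; rewrite !inE -val_eqE /= val_pos_small //; lia.
Qed.

Lemma run_block X o L : o + L <= n -> run X o L = (block o L \subset X).
Proof.
move=> h; apply/runP/subsetP => [hr i|hs i hi].
  by rewrite inE => /hr; rewrite pos_val.
by apply: hs; rewrite pos_block //; lia.
Qed.

(** The vertices of the block are undecided at the node [(A, B)]. *)
Definition free_block A B o L := block o L \subset B :\: A.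

Lemma free_blockP A B o L : o + L <= n ->
  reflect (forall k, o <= k < o + L -> (pos k \in B) && (pos k \notin A))
    (free_block A B o L).
Proof.
move=> h; apply: (iffP subsetP) => [hf k hk|hf i].
  have := hf (pos k); rewrite pos_block ?inE ?hk; last by lia.
  by rewrite andbC => ->.
by rewrite inE => /hf; rewrite pos_val inE andbC.
Qed.

(** Reading from left to right stops at the first missing vertex [o + a]; the vertices beyond it
    stay undecided. *)
Lemma dtree_read Q z L A B o : o + L <= n -> free_block A B o L ->
  (forall a, a < L -> dtree Q z (A :|: block o a) (B :\ pos (o + a))) ->
  dtree Q z (A :|: block o L) B -> dtree Q z A B.
Proof.
move=> h /(free_blockP _ _ h) hf; elim: L h hf => [|L IH] h hf h0 h1.
  by rewrite block0 setU0 in h1.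
apply: IH => [|k hk|a ha|]; [lia|by apply: hf; lia|by apply: h0; lia|].
have /andP[kB kA] := hf (o + L) ltac:(lia).
apply: (@dt_split _ _ _ (pos (o + L))) => //.
- by rewrite in_setU negb_or kA pos_block; lia.
- by rewrite setUCA -blockS //; lia.
by apply: h0.
Qed.

(** Reading from right to left stops at the last missing vertex [o + a]; the vertices before it stay
    undecided. *)
Lemma dtree_read_back Q z L A B o : o + L <= n -> free_block A B o L ->
  (forall a, a < L ->
    dtree Q z (A :|: block (o + a).+1 (L - a.+1)) (B :\ pos (o + a))) ->
  dtree Q z (A :|: block o L) B -> dtree Q z A B.
Proof.
move=> h /(free_blockP _ _ h) hf; elim: L o h hf => [|L IH] o h hf h0 h1.
  by rewrite block0 setU0 in h1.
apply: (IH o.+1) => [|k hk|a ha|]; [lia|by apply: hf; lia| |].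
  by rewrite addSnnS; have := h0 a.+1 ltac:(lia); rewrite subSS.
have /andP[kB kA] := hf o ltac:(lia).
apply: (@dt_split _ _ _ (pos o)) => //.
- by rewrite in_setU negb_or kA pos_block; lia.
- by rewrite setUCA -block_Sl //; lia.
by have := h0 0 ltac:(lia); rewrite addn0 subn1.
Qed.

Lemma pos_eq k l : k < n -> l < n -> (pos k == pos l) = (k == l).
Proof. by move=> kn ln; rewrite -val_eqE /= !val_pos_small. Qed.

Lemma card_block o L : o + L <= n -> #|block o L| = L.
Proof.
elim: L => [|L IH] h; first by rewrite block0 cards0.
by rewrite blockS ?cardsU1 ?pos_block ?IH; arith.
Qed.

Lemma eq_run X X' o L :
  (forall i, o <= i < o + L -> (pos i \in X) = (pos i \in X')) ->
  run X o L = run X' o L.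
Proof. by move=> h; apply/runP/runP => r i hi; [rewrite -h|rewrite h]; auto. Qed.

Lemma eq_norun X X' o L :
  (forall i, o <= i < o + L -> (pos i \in X) = (pos i \in X')) ->
  norun X o L = norun X' o L.
Proof.
move=> h; apply/norunP/norunP => hr j oj jL; [rewrite -(@eq_run X)|rewrite (@eq_run X X')].
all: by rewrite ?hr // => i hi; apply: h; arith.
Qed.
End Runs.

(** * Decision tree for a path *)

Section Paths.
Variables p m : nat.
Local Notation n := p.+1.
Local Notation f := (path_zeros m).
Local Notation pos := (@pos p).
Local Notation block := (@block p).
Implicit Types (A B X : {set 'I_n}) (Q : pred {set 'I_n}).

Lemma norun_small X o a : a < m -> norun m X o a.
Proof. by move=> am; apply/norunP => j; arith. Qed.

Lemma norun_split X o a N : a < N -> pos (o + a) \notin X ->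
  norun m X o N = norun m X o a && norun m X (o + a).+1 (N - a.+1).
Proof.
move=> aN zX; apply/norunP/andP => [h|[/norunP h1 /norunP h2] j oj jN].
  by split; apply/norunP => j oj jN; apply: h; arith.
have [ja|aj] := leqP (j + m) (o + a); first exact: h1.
have [ja|ja] := leqP j (o + a); last by apply: h2; arith.
by apply/negP => /runP/(_ (o + a)) h; rewrite h // in zX; arith.
Qed.

Lemma norun_after0 X o N : norun_after m 0 X o N = norun m X o N.
Proof.
rewrite /norun_after subn0; case: norunP => // h.
by have [mN|] := leqP m N => //=; rewrite h //; arith.
Qed.

(** The missing vertex breaks the initial run, and fewer than [m] vertices precede it, so these are
    unconstrained. *)
Lemma norun_after_zero h X o N a : a < N -> a < m - h -> pos (o + a) \notin X ->
  norun_after m h X o N = norun m X (o + a).+1 (N - a.+1).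
Proof.
move=> aN ah zX; rewrite /norun_after (norun_split aN zX).
rewrite norun_small ?andTb; last by arith.
case: (norun _ _ _ _) => //=; rewrite negb_and; apply/orP; right.
by apply/negP => /runP/(_ (o + a)) h'; rewrite h' // in zX; arith.
Qed.

Lemma norun_after_zero2 h X o N a e : a < m - h -> m - h <= e -> e <= a + m ->
  e < N -> pos (o + a) \notin X -> pos (o + e) \notin X ->
  norun_after m h X o N = norun m X (o + e).+1 (N - e.+1).
Proof.
move=> ah he ea eN zX zX'; rewrite (norun_after_zero _ ah zX); last by arith.
have oe : (o + a).+1 + (e - a.+1) = o + e by arith.
rewrite (@norun_split _ _ (e - a.+1)) ?oe //; last by arith.
rewrite norun_small ?andTb; last by arith.
by congr (norun _ _ _ _); arith.
Qed.

Lemma norun_afterN h X o N : N < m - h -> norun_after m h X o N.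
Proof.
move=> hN; rewrite /norun_after norun_small; last by arith.
by rewrite leqNgt hN.
Qed.

Hypothesis m_gt0 : 0 < m.

(** The budget is [f (N + h).+1] less one: a missing vertex in front of the [h] present ones is
    counted as paid for already. Behind any missing vertex that is read, an ordinary path with
    [h = 0] remains. *)
Lemma path_dtree N h o A B z Q : h < m -> o + N <= n -> free_block A B o N ->
  A \subset B ->
  (forall X, A \subset X -> X \subset B -> Q X = norun_after m h X o N) ->
  #|~: B| + f (N + h).+1 <= z.+1 -> dtree Q z A B.
Proof.
have [N0] := ubnP N; elim: N0 N h o A B => // N0 IH N h o A B NN0.
move=> hm oN fr AB hQ hz.
have posB k : o <= k < o + N -> pos k \in B.
  by move=> hk; have /andP[] := free_blockP _ _ oN fr k hk.
have [Nh|hN] := ltnP N (m - h).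
  apply: dt_leaf => // [X AX XB|]; first by rewrite hQ // norun_afterN.
  have: 0 < f (N + h).+1 by apply: path_zeros_gt0.
  by arith.
have [s [s0 sm st hs]] := path_zeros_drop m_gt0 (ltn0Sn (N + h)).
(* The number of vertices left free: a missing vertex at position [c] or later leaves at most
   [N + h - s] vertices, which lowers [f]. *)
pose c := s - h.+1.
have cm : c <= m - h.+1 by arith.
have fr1 : free_block A B (o + c) (m - h - c).
  apply/free_blockP => [|k hk]; first by arith.
  by apply: (free_blockP _ _ oN fr); arith.
apply: (dtree_read _ fr1) => [|a ha|]; first by arith.
  have zB : pos (o + c + a) \in B by apply: posB; arith.
  have zA : pos (o + c + a) \notin A.
    by have /andP[] := free_blockP _ _ oN fr (o + c + a) ltac:(arith).
  apply: (IH (N - (c + a).+1) 0 (o + (c + a)).+1) => //; try arith.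
  - apply/free_blockP => [|k hk]; first by arith.
    have /andP[kB kA] := free_blockP _ _ oN fr k ltac:(arith).
    by rewrite in_setD1 in_setU kB (negbTE kA) pos_block ?pos_eq; arith.
  - rewrite subUset subsetD1 AB zA /= subsetD1 pos_block; last by arith.
    rewrite ltnn andbF andbT; apply/subsetP => i; rewrite inE => hi.
    by rewrite -(pos_val i) posB //; arith.
  - move=> X; rewrite subUset subsetD1 => /andP[AX aX] /andP[XB zX].
    by rewrite hQ // norun_after0 (norun_after_zero (a := c + a)) ?addnA //; arith.
  - rewrite cardsCD1 //.
    have: f (N - (c + a).+1 + 0).+1 <= f ((N + h).+1 - s).
      by apply: path_zeros_mono; arith.
    by arith.
set A1 := A :|: _.
have A1B : A1 \subset B.
  rewrite subUset AB; apply/subsetP => i; rewrite inE => hi.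
  by rewrite -(pos_val i) posB //; arith.
have fr2 : free_block A1 B o c.
  apply/free_blockP => [|k hk]; first by arith.
  have /andP[kB kA] := free_blockP _ _ oN fr k ltac:(arith).
  by rewrite in_setU kB (negbTE kA) pos_block; arith.
have run1 X : A1 \subset X -> run X (o + c) (m - h - c).
  by rewrite subUset run_block => [/andP[_ ->] //|]; arith.
apply: (dtree_read_back _ fr2) => [|a ha|]; first by arith.
  set A2 := A1 :|: _.
  have zB : pos (o + a) \in B by apply: posB; arith.
  have zA : pos (o + a) \notin A2.
    have /andP[_ kA] := free_blockP _ _ oN fr (o + a) ltac:(arith).
    by rewrite !in_setU (negbTE kA) !pos_block; arith.
  have A2B : A2 \subset B :\ pos (o + a).
    rewrite subsetD1 zA subUset A1B !andbT; apply/subsetP => i; rewrite inE => hi.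
    by rewrite -(pos_val i) posB //; arith.
  have run2 X : A2 \subset X -> run X (o + a).+1 (m - h - a.+1).
    rewrite subUset => /andP[/run1/runP h1]; rewrite -run_block; last by arith.
    move/runP => h2; apply/runP => i hi.
    by have [ic|ci] := ltnP i (o + c); [apply: h2|apply: h1]; arith.
  (* The vertices from [a + 1] to [m - h - 1] are present, so the second missing vertex is sought
     from [m - h] up to [a + m] or the end of the block. *)
  pose L := minn (a + m.+1) N - (m - h).
  have fr3 : free_block A2 (B :\ pos (o + a)) (o + (m - h)) L.
    apply/free_blockP => [|k hk]; first by rewrite /L; arith.
    have /andP[kB kA] := free_blockP _ _ oN fr k ltac:(rewrite /L in hk; arith).
    by rewrite in_setD1 !in_setU kB (negbTE kA) !pos_block ?pos_eq; rewrite /L in hk; arith.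
  apply: (dtree_read _ fr3) => [|b hb|]; first by rewrite /L; arith.
    have {hb} [hb1 hb2] : m - h + b <= a + m /\ m - h + b < N by move: hb; rewrite /L; arith.
    clear L fr3.
    have zB' : pos (o + (m - h) + b) \in B.
      by apply: posB; arith.
    have zA' : pos (o + (m - h) + b) \notin A2.
      have /andP[_ kA] := free_blockP _ _ oN fr (o + (m - h) + b) ltac:(arith).
      by rewrite !in_setU (negbTE kA) !pos_block; arith.
    apply: (IH (N - (m - h + b).+1) 0 (o + (m - h + b)).+1) => //; try arith.
    - apply/free_blockP => [|k hk]; first by arith.
      have /andP[kB kA] := free_blockP _ _ oN fr k ltac:(arith).
      by rewrite !in_setD1 !in_setU kB (negbTE kA) !pos_block ?pos_eq; arith.
    - rewrite subUset subsetD1 A2B zA' /= subsetD1 pos_block; last by arith.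
      rewrite ltnn andbF andbT; apply/subsetP => i; rewrite inE => hi.
      rewrite -(pos_val i) in_setD1 pos_eq ?posB; arith.
    - move=> X; rewrite subUset !subsetD1 => /andP[AX aX] /andP[/andP[XB zX] zX'].
      rewrite hQ //; last by move: AX; rewrite !subUset => /andP[/andP[]].
      rewrite norun_after0 (norun_after_zero2 (a := a) (e := m - h + b)) //; try arith.
      by rewrite addnA.
    - rewrite cardsCD1; last by rewrite in_setD1 zB' pos_eq; arith.
      rewrite cardsCD1 //.
      have: f (N - (m - h + b).+1 + 0).+1 + 2 <= f (N + h).+1.
        by rewrite -path_zerosD; apply: path_zeros_mono; arith.
      by arith.
  (* Without a second missing vertex, either a full run follows [o + a] or the block is
     exhausted. *)
  have [aN|Na] := leqP (a + m.+1) N.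
    apply: dt_dead => X; rewrite subUset subsetD1 => /andP[AX rX] /andP[XB zX].
    rewrite hQ //; last by move: AX; rewrite !subUset => /andP[/andP[]].
    rewrite negb_and; apply/orP; left; apply/negP => /norunP/(_ (o + a).+1) h'.
    have /negP[] := h' ltac:(arith) ltac:(arith).
    move: rX; rewrite -run_block; last by rewrite /L; arith.
    move/runP => r2; have /runP r1 := run2 _ AX.
    apply/runP => i hi.
    by have [ic|ci] := ltnP i (o + (m - h)); [apply: r1|apply: r2]; rewrite /L; arith.
  apply: dt_leaf.
  - rewrite subUset A2B subsetD1 pos_block ?andTb; last by arith.
    rewrite andbC /L; apply/andP; split; first by arith.
    apply/subsetP => i; rewrite inE => hi.
    by rewrite -(pos_val i) posB //; arith.
  - move=> X; rewrite subUset subsetD1 => /andP[AX rX] /andP[XB zX].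
    rewrite hQ //; last by move: AX; rewrite !subUset => /andP[/andP[]].
    by rewrite (norun_after_zero (a := a)) ?norun_small //; arith.
  - rewrite cardsCD1 //.
    have: f (0 + m.+1) <= f (N + h).+1 by apply: path_zeros_mono; arith.
    by rewrite path_zerosD; arith.
(* The first [m - h] vertices are present and complete a run with the [h] vertices before the
   block. *)
apply: dt_dead => X; rewrite subUset => /andP[AX rX] XB.
rewrite hQ //; last by move: AX; rewrite subUset => /andP[].
rewrite negb_and; apply/orP; right; rewrite negbK hN /=.
have /runP r1 := run1 _ AX; move: rX; rewrite -run_block => [/runP r2|]; last by arith.
by apply/runP => i hi; have [ic|ci] := ltnP i (o + c); [apply: r2|apply: r1]; arith.
Qed.
End Paths.

(** * Blocks that may begin with a run *)

Section Tails.
Variables p m : nat.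
Local Notation n := p.+1.
Local Notation f := (path_zeros m).
Local Notation pos := (@pos p).
Local Notation block := (@block p).
Implicit Types (A B X : {set 'I_n}) (Q : pred {set 'I_n}).

Hypothesis m_gt0 : 0 < m.

(** A run that does not begin at [o] has its predecessor present, so it can be moved one place to
    the left, and so on down to [o]. *)
Lemma norun_tail_run X o N j : norun_tail m X o N -> o <= j ->
  j + m <= o + N -> run X j m -> run X o (j - o + m).
Proof.
move=> /norun_tailP ht; elim: j => [|j IH] oj jN rj.
  by have ->: o = 0; [arith|].
have [oj'|jo] := leqP o j; last first.
  by have ->: o = j.+1; [arith|rewrite subnn add0n].
have jX := ht j oj' jN rj; have /runP rj' := rj.
have /runP ro : run X o (j - o + m).
  apply: IH => //; first by arith.
  apply/runP => i hi; have [->//|ij] := eqVneq i j.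
  by apply: rj'; arith.
apply/runP => i hi; have [ij|ji] := ltnP i (j + m); first by apply: ro; arith.
by apply: rj'; arith.
Qed.

Lemma norun_norun_tail X o N :
  norun m X o N = norun_tail m X o N && ~~ ((m <= N) && run X o m).
Proof.
apply/norunP/andP => [h|[ht]].
  split; last by rewrite negb_and -implybE; apply/implyP => mN; apply: h; arith.
  by apply/norun_tailP => j oj jN rj; have /negP[] := h j.+1 ltac:(arith) jN.
move=> hr j oj jN; apply/negP => rj; case/negP: hr; apply/andP; split; first by arith.
have /runP r := norun_tail_run ht oj jN rj.
by apply/runP => i hi; apply: r; arith.
Qed.

Lemma norun_tail_small X o a : a <= m -> norun_tail m X o a.
Proof. by move=> am; apply/norun_tailP => j; arith. Qed.

Lemma norun_tail_allrun X o a : run X o a -> norun_tail m X o a.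
Proof.
by move=> /runP h; apply/norun_tailP => j oj ja _; apply: h; arith.
Qed.

Lemma norun_tail_split X o a N : a < N -> pos (o + a) \notin X ->
  norun_tail m X o N = norun_tail m X o a && norun m X (o + a).+1 (N - a.+1).
Proof.
move=> aN zX; apply/idP/andP => [h|[/norun_tailP h1 /norunP h2]].
  split.
    by apply/norun_tailP => j oj ja; apply: (norun_tailP _ _ _ _ h) => //; arith.
  apply/norunP => j oj jN; apply/negP => rj.
  have /runP r := @norun_tail_run X o N j h ltac:(arith) ltac:(arith) rj.
  by rewrite r // in zX; arith.
apply/norun_tailP => j oj jN rj.
have [ja|aj] := leqP (j.+1 + m) (o + a); first exact: h1.
have [ja|ja] := leqP j.+1 (o + a); last first.
  by have /negP[] := h2 j.+1 ltac:(arith) ltac:(arith).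
by move/runP/(_ (o + a)): rj => r; rewrite r // in zX; arith.
Qed.

(** The first missing vertex after the known initial segment ends the admissible initial run; an
    ordinary path remains behind it. *)
Lemma tail_run_dtree N a0 o A B z Q : a0 <= N -> o + N <= n ->
  block o a0 \subset A -> free_block A B (o + a0) (N - a0) -> A \subset B ->
  (forall X, A \subset X -> X \subset B -> Q X = norun_tail m X o N) ->
  #|~: B| + f (N - a0) <= z -> dtree Q z A B.
Proof.
move=> aN oN a0A fr AB hQ hz.
have hfr := free_blockP _ _ (_ : (o + a0) + (N - a0) <= n) fr.
have posB k : o + a0 <= k < o + N -> (pos k \in B) && (pos k \notin A).
  by move=> hk; apply: hfr; arith.
have runX X b : b <= N - a0 -> A :|: block (o + a0) b \subset X -> run X o (a0 + b).
  rewrite subUset => hb /andP[AX]; rewrite -run_block; last by arith.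
  have: run X o a0 by rewrite run_block ?(subset_trans a0A) //; arith.
  move=> /runP r1 /runP r2; apply/runP => i hi.
  by have [ic|ci] := ltnP i (o + a0); [apply: r1|apply: r2]; arith.
apply: (dtree_read _ fr) => [|a ha|]; first by arith.
  have /andP[zB zA] := posB (o + a0 + a) ltac:(arith).
  apply: (@path_dtree _ _ m_gt0 (N - (a0 + a).+1) 0 (o + (a0 + a)).+1) => //; try arith.
  - apply/free_blockP => [|k hk]; first by arith.
    have /andP[kB kA] := posB k ltac:(arith).
    by rewrite in_setD1 in_setU kB (negbTE kA) pos_block ?pos_eq; arith.
  - rewrite subUset subsetD1 AB zA /= subsetD1 pos_block; last by arith.
    rewrite ltnn andbF andbT; apply/subsetP => i; rewrite inE => hi.
    by rewrite -(pos_val i); have /andP[] := posB i ltac:(arith).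
  - move=> X AX; rewrite subsetD1 => /andP[XB zX].
    rewrite hQ //; last by move: AX; rewrite subUset => /andP[].
    rewrite norun_after0 (norun_tail_split (a := a0 + a)) ?addnA //; last by arith.
    by rewrite norun_tail_allrun //; apply: runX => //; arith.
  - rewrite cardsCD1 // addn0.
    have: f (N - (a0 + a).+1).+1 <= f (N - a0) by apply: path_zeros_mono; arith.
    by arith.
apply: dt_leaf; last by arith.
  rewrite subUset AB; apply/subsetP => i; rewrite inE => hi.
  by rewrite -(pos_val i); have /andP[] := posB i ltac:(arith).
move=> X AX XB; rewrite hQ //; last by move: AX; rewrite subUset => /andP[].
by apply: norun_tail_allrun; have := runX X (N - a0) (leqnn _) AX; rewrite subnKC.
Qed.

(** The tree of [path_dtree] with [h = 0], except that the window reaches one vertex further, since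
    even a missing vertex at position [m] leaves those before it unconstrained. A full initial
    segment of [m.+1] vertices is not dead; it goes to [tail_run_dtree] and saves [m.+1] vertices,
    which is two in the budget. *)
Lemma tail_dtree N o A B z Q : o + N <= n -> free_block A B o N -> A \subset B ->
  (forall X, A \subset X -> X \subset B -> Q X = norun_tail m X o N) ->
  #|~: B| + f N.+1 <= z.+1 -> dtree Q z A B.
Proof.
move=> oN fr AB hQ hz; have hfr := free_blockP _ _ oN fr.
have posB k : o <= k < o + N -> pos k \in B by move=> /hfr/andP[].
have posA k : o <= k < o + N -> pos k \notin A by move=> /hfr/andP[].
have [Nm|mN] := leqP N m.
  apply: dt_leaf => // [X AX XB|]; first by rewrite hQ // norun_tail_small.
  have: 0 < f N.+1 by apply: path_zeros_gt0.
  by arith.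
have [s [s0 sm st hs]] := path_zeros_drop m_gt0 (ltn0Sn N).
pose c := s.-1.
have fr1 : free_block A B (o + c) (m.+1 - c).
  by apply/free_blockP => [|k hk]; [arith|apply: hfr; arith].
apply: (dtree_read _ fr1) => [|a ha|]; first by arith.
  have zB : pos (o + c + a) \in B by apply: posB; arith.
  have zA : pos (o + c + a) \notin A by apply: posA; arith.
  apply: (@path_dtree _ _ m_gt0 (N - (c + a).+1) 0 (o + (c + a)).+1) => //; try arith.
  - apply/free_blockP => [|k hk]; first by arith.
    have /andP[kB kA] := hfr k ltac:(arith).
    by rewrite in_setD1 in_setU kB (negbTE kA) pos_block ?pos_eq; arith.
  - rewrite subUset subsetD1 AB zA /= subsetD1 pos_block; last by arith.
    rewrite ltnn andbF andbT; apply/subsetP => i; rewrite inE => hi.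
    by rewrite -(pos_val i) posB //; arith.
  - move=> X AX; rewrite subsetD1 => /andP[XB zX].
    rewrite hQ //; last by move: AX; rewrite subUset => /andP[].
    rewrite norun_after0 (norun_tail_split (a := c + a)) ?addnA //; last by arith.
    by rewrite norun_tail_small //; arith.
  - rewrite cardsCD1 // addn0.
    have: f (N - (c + a).+1).+1 <= f (N.+1 - s) by apply: path_zeros_mono; arith.
    by arith.
set A1 := A :|: _.
have A1B : A1 \subset B.
  rewrite subUset AB; apply/subsetP => i; rewrite inE => hi.
  by rewrite -(pos_val i) posB //; arith.
have fr2 : free_block A1 B o c.
  apply/free_blockP => [|k hk]; first by arith.
  have /andP[kB kA] := hfr k ltac:(arith).
  by rewrite in_setU kB (negbTE kA) pos_block; arith.
apply: (dtree_read_back _ fr2) => [|a ha|]; first by arith.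
  set A2 := A1 :|: _.
  have zB : pos (o + a) \in B by apply: posB; arith.
  have zA : pos (o + a) \notin A2.
    by rewrite !in_setU (negbTE (posA _ _)) ?pos_block; arith.
  have A2B : A2 \subset B :\ pos (o + a).
    rewrite subsetD1 zA subUset A1B !andbT; apply/subsetP => i; rewrite inE => hi.
    by rewrite -(pos_val i) posB //; arith.
  have run2 X : A2 \subset X -> run X (o + a).+1 (m.+1 - a.+1).
    rewrite !subUset -!run_block; try arith.
    move=> /andP[/andP[_ /runP h1] /runP h2]; apply/runP => i hi.
    by have [ic|ci] := ltnP i (o + c); [apply: h2|apply: h1]; arith.
  pose L := minn (a + m.+1) N - m.+1.
  have fr3 : free_block A2 (B :\ pos (o + a)) (o + m.+1) L.
    apply/free_blockP => [|k hk]; first by rewrite /L; arith.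
    have /andP[kB kA] := hfr k ltac:(rewrite /L in hk; arith).
    by rewrite in_setD1 !in_setU kB (negbTE kA) !pos_block ?pos_eq; rewrite /L in hk; arith.
  apply: (dtree_read _ fr3) => [|b hb|]; first by rewrite /L; arith.
    have {hb} [hb1 hb2] : m.+1 + b <= a + m /\ m.+1 + b < N by move: hb; rewrite /L; arith.
    clear L fr3.
    have zB' : pos (o + m.+1 + b) \in B by apply: posB; arith.
    have zA' : pos (o + m.+1 + b) \notin A2.
      have kA := posA (o + m.+1 + b) ltac:(arith).
      by rewrite !in_setU (negbTE kA) !pos_block; arith.
    apply: (@path_dtree _ _ m_gt0 (N - (m.+1 + b).+1) 0 (o + (m.+1 + b)).+1) => //; try arith.
    - apply/free_blockP => [|k hk]; first by arith.
      have /andP[kB kA] := hfr k ltac:(arith).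
      by rewrite !in_setD1 !in_setU kB (negbTE kA) !pos_block ?pos_eq; arith.
    - rewrite subUset subsetD1 A2B zA' /= subsetD1 pos_block; last by arith.
      rewrite ltnn andbF andbT; apply/subsetP => i; rewrite inE => hi.
      rewrite -(pos_val i) in_setD1 pos_eq ?posB; arith.
    - move=> X; rewrite subUset !subsetD1 => /andP[AX aX] /andP[/andP[XB zX] zX'].
      rewrite hQ //; last by move: AX; rewrite !subUset => /andP[/andP[]].
      rewrite norun_after0 (norun_tail_split (a := m.+1 + b)) ?addnA //.
      rewrite (norun_tail_split (a := a)) //; last by arith.
      rewrite norun_tail_small ?andTb; last by arith.
      by rewrite norun_small //; arith.
    - rewrite cardsCD1; last by rewrite in_setD1 zB' pos_eq; arith.
      rewrite cardsCD1 //.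
      have: f (N - (m.+1 + b).+1 + 0).+1 + 2 <= f N.+1.
        by rewrite -path_zerosD; apply: path_zeros_mono; arith.
      by arith.
  have [aN|Na] := leqP (a + m.+1) N.
    apply: dt_dead => X; rewrite subUset subsetD1 => /andP[AX rX] /andP[XB zX].
    rewrite hQ //; last by move: AX; rewrite !subUset => /andP[/andP[]].
    apply/negP => /norun_tailP/(_ (o + a)) h'; case/negP: zX.
    apply: h'; [arith|arith|].
    move: rX; rewrite -run_block; last by rewrite /L; arith.
    move/runP => r2; have /runP r1 := run2 _ AX.
    apply/runP => i hi.
    by have [ic|ci] := ltnP i (o + m.+1); [apply: r1|apply: r2]; rewrite /L; arith.
  apply: dt_leaf.
  - rewrite subUset A2B subsetD1 pos_block ?andTb; last by arith.
    rewrite andbC /L; apply/andP; split; first by arith.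
    apply/subsetP => i; rewrite inE => hi.
    by rewrite -(pos_val i) posB //; arith.
  - move=> X; rewrite subUset subsetD1 => /andP[AX rX] /andP[XB zX].
    rewrite hQ //; last by move: AX; rewrite !subUset => /andP[/andP[]].
    by rewrite (norun_tail_split (a := a)) ?norun_tail_small ?norun_small //; arith.
  - rewrite cardsCD1 //.
    have: f (0 + m.+1) <= f N.+1 by apply: path_zeros_mono; arith.
    by rewrite path_zerosD; arith.
apply: (@tail_run_dtree N m.+1 o) => //.
- by apply/subsetP => i; rewrite /A1 !inE => hi; case: (i \in A) => //=; arith.
- apply/free_blockP => [|k hk]; first by arith.
  have /andP[kB kA] := hfr k ltac:(arith).
  by rewrite !in_setU kB (negbTE kA) !pos_block; arith.
- rewrite subUset A1B; apply/subsetP => i; rewrite inE => hi.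
  by rewrite -(pos_val i) posB //; arith.
- move=> X AX XB; apply: hQ => //.
  by move: AX; rewrite !subUset => /andP[/andP[]].
have: f (N - m.+1 + m.+1) <= f N.+1 by apply: path_zeros_mono; arith.
by rewrite path_zerosD; arith.
Qed.
End Tails.

(** * Decision trees for the cycle *)

Section Cycle.
Variables p m : nat.
Local Notation n := p.+1.
Local Notation f := (path_zeros m).
Local Notation pos := (@pos p).
Local Notation block := (@block p).
Implicit Types (A B X : {set 'I_n}) (Q : pred {set 'I_n}).
Hypothesis m_lt_n : m < n.

Definition has_run X := has (fun j => run X j m) (iota 0 n).

Lemma has_runP X : reflect (exists j, run X j m) (has_run X).
Proof.
apply: (iffP hasP) => [[j _ rj]|[j rj]]; first by exists j.
by exists (j %% n); rewrite ?run_mod // mem_iota add0n ltn_mod.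
Qed.

Lemma has_runS (X Y : {set 'I_n}) : X \subset Y -> has_run X -> has_run Y.
Proof.
move=> /subsetP XY /has_runP[j /runP rj]; apply/has_runP; exists j.
by apply/runP => i /rj/XY.
Qed.

(** The cycle is cut at the missing vertex [n - h - 1]; the [h] present vertices after it cyclically
    precede vertex 0. *)
Lemma cycle_norun_after h X : h < m -> block (n - h) h \subset X ->
  pos (n - h.+1) \notin X -> ~~ has_run X = norun_after m h X 0 (n - h.+1).
Proof.
move=> hm; rewrite -run_block; last by arith.
move=> /runP rh zX.
have not_z j L : run X j L -> j <= n - h.+1 < j + L -> False.
  by move=> /runP r /r; rewrite (negbTE zX).
apply/negP/andP => [hr|[/norunP h1 h2]].
  split; first by apply/norunP => j _ _; apply/negP => rj; apply/hr/has_runP; exists j.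
  rewrite negb_and -implybE; apply/implyP => _; apply/negP => /runP r0.
  apply/hr/has_runP; exists (n - h); apply/runP => i hi.
  have [ii|ii] := ltnP i n; first by apply: rh; arith.
  by rewrite -(subnK ii) posDn; apply: r0; arith.
case/hasP => j; rewrite mem_iota => /andP[_ jn] rj; have nz := not_z _ _ rj.
have [jh|hj] := leqP (j + m) (n - h.+1).
  by case/negP: (h1 j ltac:(arith) ltac:(arith)).
case/negP: h2; apply/andP; split; first by arith.
have {hj} hj : n - h <= j.
  by rewrite leqNgt; apply/negP => lt; apply: nz; arith.
move/runP: rj => rj; apply/runP => i hi; rewrite -posDn; apply: rj; arith.
Qed.

Hypothesis m_gt0 : 0 < m.

(** The last [m] vertices are read backwards to find the place of the cut. The cut vertex costs 1
    and the path the remaining [f n - 1]. *)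
Lemma cycle_dtree : dtree (fun X => ~~ has_run X) (f n) set0 setT.
Proof.
have h0 : (n - m) + m = n by rewrite subnK // ltnW.
have posn k : n - m <= k < n - m + m -> (pos k \in [set: 'I_n]) && (pos k \notin set0).
  by rewrite !inE.
have fr : @free_block p set0 setT (n - m) m by apply/free_blockP => //; arith.
apply: (dtree_read_back _ fr) => [|a ha|]; first by arith.
  have e1 : (n - m + a).+1 = n - (m - a.+1) by arith.
  have e2 : n - m + a = n - (m - a.+1).+1 by arith.
  have hm : m - a.+1 < m by arith.
  rewrite set0U e1 e2; move: (m - a.+1) hm => h hm {a ha e1 e2 posn fr}.
  apply: (@path_dtree p m m_gt0 (n - h.+1) h 0) => //; try arith.
  - apply/free_blockP => [|k hk]; first by arith.
    by rewrite in_setD1 in_setT pos_block ?pos_eq; arith.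
  - by rewrite subsetD1 subsetT pos_block; arith.
  - move=> X AX; rewrite subsetD1 => /andP[_ zX].
    by rewrite (cycle_norun_after hm).
  - rewrite cardsCD1 ?inE // setCT cards0.
    by have ->: (n - h.+1 + h).+1 = n by arith.
apply: dt_dead => X; rewrite set0U -run_block; last by arith.
by move=> r _; rewrite negbK; apply/has_runP; exists (n - m).
Qed.

(** Modulo [n], [i + p] is the predecessor of [i], written without subtraction. *)
Definition start X i := (pos (i + p) \notin X) && run X i m.
Definition first_start X i := start X i && ~~ has (start X) (iota 0 i).

Lemma sum_first_start X k :
  \sum_(i < k) first_start X i = has (start X) (iota 0 k).
Proof.
elim: k => [|k IH]; first by rewrite big_ord0.
have -> : iota 0 k.+1 = iota 0 k ++ [:: k] by rewrite -addn1 iotaD.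
rewrite big_ord_recr has_cat /= IH orbF /first_start.
by case: has; case: start.
Qed.

(** Walking left from a run to the nearest missing vertex passes only present ones, so the [m]
    vertices next to the missing one form a run. *)
Lemma has_run_start X : X != setT -> has_run X = has (start X) (iota 0 n).
Proof.
move=> XT; apply/idP/hasP => [/has_runP[j0 rj0]|[j _ /andP[_ r]]]; last first.
  by apply/has_runP; exists j.
(* The shift by [n] leaves room to walk left without truncated subtraction. *)
have [j jn rj] : exists2 j, n <= j & run X j m.
  by exists (j0 + n); rewrite ?run_addn // leq_addl.
have ex : exists d, (d <= j.-1) && (pos (j.-1 - d) \notin X).
  have [i iX] : exists i, i \notin X.
    by apply/existsP; apply: contraNT XT => /pred0Pn h; apply/eqP/setP => i; rewrite inE;
      apply: contraT => iX; case: h; exists i; rewrite /= iX.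
  exists (j.-1 - i); have := ltn_ord i => hi.
  by rewrite leq_subr subKn ?pos_val //; arith.
case: (ex_minnP ex) => d /andP[dj zX] dmin.
exists ((j - d) %% n); first by rewrite mem_iota add0n ltn_mod.
have r : run X (j - d) m.
  apply/runP => i hi; have [ij|ji] := ltnP i j; last by move/runP: rj; apply; arith.
  apply/negPn/negP => iX; have := dmin (j.-1 - i); rewrite subKn; last by arith.
  by rewrite iX leq_subr => /(_ isT); arith.
apply/andP; split; last by rewrite run_mod.
rewrite -pos_mod modnDml pos_mod.
by have ->: j - d + p = j.-1 - d + n; [arith|rewrite posDn].
Qed.

Local Notation z := (f n.+1 - 2).

Lemma path_zeros_cycle : f (n - m) + 2 = f n.+1.
Proof. by rewrite -path_zerosD; congr (f _); arith. Qed.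

Lemma first_start0_partition :
  interval_partition (fun X => first_start X 0) z.
Proof.
have f0 : 0 < f (n - m) by apply: path_zeros_gt0; arith.
have zz := path_zeros_cycle.
have AB : block 0 m \subset setT :\ pos p.
  by rewrite subsetD1 subsetT pos_block; arith.
apply: eq_interval_partition (interval_partition1 AB (z := z) _) => [X|].
  by rewrite /interval /first_start /start /= andbT run_block ?subsetD1 ?subsetT 1?andbC //; arith.
rewrite cardsCD1 ?inE // setCT cards0; arith.
Qed.

Lemma start_pred X i : 0 < i -> (pos (i + p) \notin X) = (pos i.-1 \notin X).
Proof. by move=> i0; rewrite -(posDn _ i.-1); congr (pos _ \notin X); arith. Qed.

(** The block of the [i.-1] vertices before the missing one must contain no start. A start other
    than 0 is excluded by [norun_tail]; a start at 0 is excluded either because there is no run at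
    0, which gives [Ta], or because there is one and its predecessor [p] is present, which gives
    [Tb]. *)
Lemma first_start_partition_inner i : 0 < i -> i + m <= n ->
  interval_partition (fun X => first_start X i) z.
Proof.
move=> i0 im; have zz := path_zeros_cycle.
pose A0 := block i m; pose B0 := setT :\ pos i.-1.
have cB0 : #|~: B0| = 1 by rewrite cardsCD1 ?inE // setCT cards0.
have A0B0 : A0 \subset B0 by rewrite subsetD1 subsetT pos_block; arith.
have fm : f i <= f (n - m) by apply: path_zeros_mono; arith.
have Ta : dtree (fun X => norun m X 0 i.-1) z A0 B0.
  apply: (@path_dtree p m m_gt0 i.-1 0 0) => //; try arith.
  - apply/free_blockP => [|k hk]; first by arith.
    by rewrite in_setD1 in_setT pos_block ?pos_eq; arith.
  - by move=> X _ _; rewrite norun_after0.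
  - by rewrite cB0 addn0 prednK //; arith.
pose A1 := A0 :|: block 0 m :|: [set pos p].
have posp : p < n by [].
(* The guard concerns a block too short for a run at 0, which would then contain the missing vertex
   [i.-1]. *)
have Tb : dtree (fun X => (m <= i.-1) && norun_tail m X 0 i.-1) z A1 B0.
  have [mi|mi] := leqP m i.-1; last by apply: dt_dead.
  apply: (@tail_run_dtree p m m_gt0 i.-1 m 0) => //; try arith.
  - by rewrite /A1 -setUA setUCA subsetUl.
  - apply/free_blockP => [|k hk]; first by arith.
    by rewrite in_setD1 in_setT !in_setU in_set1 !pos_block ?pos_eq; arith.
  - rewrite !subUset A0B0 subsetD1 subsetT pos_block ?sub1set ?in_setD1 ?in_setT ?pos_eq; arith.
  - rewrite cB0; have: f (i.-1 - m + m.+1) <= f i by apply: path_zeros_mono; arith.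
    by rewrite path_zerosD; arith.
apply: interval_partitionU (dtree_partition Ta) (dtree_partition Tb) => X.
rewrite /interval /first_start /start start_pred //.
rewrite run_block // -/A0.
have -> : (X \subset B0) = (pos i.-1 \notin X) by rewrite subsetD1 subsetT.
have -> : (A1 \subset X) = [&& A0 \subset X, run X 0 m & pos p \in X].
  by rewrite !subUset sub1set -run_block ?andbA //; arith.
have [AX|] := boolP (A0 \subset X); last by rewrite andbF.
have [iX|iX] := boolP (pos i.-1 \in X) => /=; first by rewrite !andbF.
rewrite !andbT (norun_norun_tail m_gt0).
have runm : run X 0 m -> m <= i.-1.
  move=> /runP r; rewrite leqNgt; apply/negP => lt.
  by rewrite r // in iX; arith.
have -> : has (start X) (iota 0 i) = ~~ norun_tail m X 0 i.-1 || ((pos p \notin X) && run X 0 m).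
  apply/hasP/orP => [[j]|].
    rewrite mem_iota /= add0n => ji /andP[].
    case: j ji => [|j] ji; first by rewrite add0n => -> ->; right.
    rewrite start_pred //= => jX rj; left.
    apply/negP => /norun_tailP/(_ j (leq0n _)); rewrite rj (negbTE jX).
    have jm : j.+1 + m <= i.-1.
      rewrite leqNgt; apply/negP => lt; move/runP/(_ i.-1): rj => rj.
      by rewrite rj // in iX; arith.
    by move=> /(_ jm isT).
  case=> [h|/andP[h1 h2]]; last first.
    by exists 0; rewrite ?mem_iota ?add0n // /start h1 h2.
  have /allPn[j] := h; rewrite mem_iota => /andP[_ ji].
  rewrite !negb_imply => /and3P[jm rj jX]; exists j.+1; first by rewrite mem_iota; arith.
  by rewrite /start start_pred // jX.
have [r|r] := boolP (run X 0 m); last by rewrite !andbF /= ?andbT ?orbF negbK addn0.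
rewrite runm //=; case: (norun_tail _ _ _ _) => //=; by case: (pos p \in X).
Qed.

(** The run covers the first [w] vertices, so the block behind them follows a present vertex: a run
    at its beginning is no start, which is what [norun_tail] allows. The block has [n - m - 1]
    vertices. *)
Lemma first_start_partition_wrap i : i < n -> n < i + m ->
  interval_partition (fun X => first_start X i) z.
Proof.
move=> ilt im; have zz := path_zeros_cycle.
pose w := i + m - n.
pose A0 := block i (n - i) :|: block 0 w; pose B0 := setT :\ pos i.-1.
have cB0 : #|~: B0| = 1 by rewrite cardsCD1 ?inE // setCT cards0.
have A0B0 : A0 \subset B0.
  by rewrite subUset !subsetD1 !subsetT !pos_block /w; arith.
have T : dtree (fun X => norun_tail m X w (i.-1 - w)) z A0 B0.
  apply: (@tail_dtree p m m_gt0 (i.-1 - w) w) => //; try arith.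
  - apply/free_blockP => [|k hk]; first by rewrite /w; arith.
    by rewrite in_setD1 in_setT in_setU !pos_block ?pos_eq; rewrite /w in hk *; arith.
  - rewrite cB0; have ->: (i.-1 - w).+1 = n - m by rewrite /w; arith.
    by arith.
apply: eq_interval_partition (dtree_partition T) => X.
rewrite /interval /first_start /start start_pred; last by arith.
have -> : (X \subset B0) = (pos i.-1 \notin X) by rewrite subsetD1 subsetT.
have <- : run X i m = (A0 \subset X).
  rewrite subUset -!run_block; try by rewrite /w; arith.
  apply/runP/andP => [r|[/runP r1 /runP r2] k hk].
    split; apply/runP => k hk; first by apply: r; arith.
    by rewrite -posDn; apply: r; rewrite /w in hk; arith.
  have [kn|nk] := ltnP k n; first by apply: r1; arith.
  by rewrite -(subnK nk) posDn; apply: r2; rewrite /w; arith.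
rewrite [run X i m && _]andbC.
have [/runP ri|] := boolP (run X i m); last by rewrite andbF.
have [iX|iX] := boolP (pos i.-1 \in X) => //=.
have rw k : k < w -> pos k \in X.
  by move=> kw; rewrite -posDn; apply: ri; rewrite /w in kw; arith.
apply/norun_tailP/hasPn => [h j|h j wj jm rj].
  rewrite mem_iota => /andP[_ ji]; apply/negP => /andP[jX rj].
  case: j ji jX rj => [|j] ji jX rj.
    by rewrite add0n ri // in jX; arith.
  rewrite start_pred // in jX.
  have jw : w <= j by rewrite leqNgt; apply/negP => /rw; rewrite (negbTE jX).
  rewrite (h j jw) //= in jX.
  rewrite leqNgt; apply/negP => lt; move/runP/(_ i.-1): rj => rj.
  by rewrite rj // in iX; rewrite /w in lt jw; arith.
have := h j.+1; rewrite mem_iota /start start_pred // rj andbT negbK /=; apply.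
by rewrite /w in jm; arith.
Qed.

Lemma has_run_partition : interval_partition has_run z.
Proof.
have parts (i : 'I_n) : interval_partition (fun X => first_start X i) z.
  have [im|im] := leqP (i + m) n; last exact: first_start_partition_wrap.
  case: (posnP i) => [->|i0]; first exact: first_start0_partition.
  exact: first_start_partition_inner.
have Q1 : interval_partition (fun X => has (start X) (iota 0 n)) z.
  by apply: interval_partition_sum parts => X; exact: sum_first_start.
have Q2 : interval_partition (interval [set: 'I_n] setT) z.
  by apply: interval_partition1; rewrite ?subxx ?setCT ?cards0.
apply: interval_partitionU Q1 Q2 => X; rewrite /interval subTset subsetT andbT.
have [->|XT] := eqVneq X setT; last by rewrite has_run_start // addn0.
have -> : has_run setT by apply/has_runP; exists 0; apply/runP => i _; rewrite inE.
by rewrite (_ : has _ _ = false) //; apply/hasPn => j _; rewrite /start inE.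
Qed.
End Cycle.

(** * A small facet of the complex of run-free sets *)

Section Facet.
Variables (p m : nat).
Local Notation n := p.+1.
Local Notation f := (path_zeros m).
Local Notation pos := (@pos p).
Local Notation d := m.+1.

(* The gaps between missing elements are m-1, 0, m-1, 0, ..., m-1, r. *)
Lemma cycle_facet : 0 < m -> m < n -> exists F : {set 'I_n},
  [/\ ~~ has_run m F, forall j, j \notin F -> has_run m (j |: F)
    & #|F| <= n.+1 - f n.+1].
Proof.
move=> m0 mn; have [Q [s [sm en fn]]] := path_zerosP m n.+1.
pose zero x := [|| x %% d == m.-1, (x %% d == m) && (x < Q.-1 * d) | x == p].
have Q0 : 0 < Q by case: Q en {fn zero} => //; arith.
have mulQ t : t < Q -> t * d + d <= Q * d.
  by move=> tQ; rewrite -mulSnr leq_mul2r tQ orbT.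
have zeroE t i : i < m.-1 -> zero (t * d + i) = (t * d + i == p).
  move=> im; rewrite /zero modnMDl modn_small; last by arith.
  by rewrite (ltn_eqF im) (_ : (i == m) = false) //; arith.
pose F : {set 'I_n} := [set i : 'I_n | ~~ zero i].
have inF k : k < n -> (pos k \in F) = ~~ zero k by move=> kn; rewrite inE val_pos_small.
exists F; split.
- apply/hasPn => j; rewrite mem_iota add0n => /andP[_ jn]; apply/negP => /runP rj.
  have nz k : j <= k < j + m -> k < n -> zero k = false.
    by move=> /rj + kn; rewrite inF // => /negbTE.
  have zp : zero p by rewrite /zero eqxx !orbT.
  (* Among the [m] vertices from [j] on, the one of residue [m.-1] is missing, or [j] itself if its
     residue is [m]; near the end of the cycle [p] takes this part. *)
  have : j %% d < d by rewrite ltn_mod.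
  have := divn_eq j d; move: (j %/ d) (j %% d) => t r ej.
  rewrite ltnS leq_eqVlt => /orP[/eqP rm|rm].
    have [tQ|Qt] := ltnP t Q.-1.
      have := nz j; rewrite /zero ej rm modnMDl modn_small // eqxx.
      rewrite (_ : t * d + m < Q.-1 * d) ?orbT; last first.
        by rewrite -addnS -mulSnr leq_mul2r tQ orbT.
      by rewrite ej rm in jn => /(_ ltac:(arith) jn).
    have Qd : Q * d <= t.+1 * d by rewrite leq_mul2r; apply/orP; right; arith.
    by rewrite nz // in zp; rewrite mulSnr in Qd; arith.
  have [kn|nk] := ltnP (t * d + m.-1) n.
    have := nz (t * d + m.-1) ltac:(arith) kn.
    by rewrite /zero modnMDl modn_small ?eqxx //; arith.
  by rewrite nz // in zp; arith.
(* Every missing vertex borders, cyclically, on a gap of length [m - 1], which it completes to a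
   run. *)
- move=> v; rewrite inE negbK => zv; apply/has_runP.
  have vn := ltn_ord v.
  have := divn_eq v d; case/or3P: zv => [/eqP -> | /andP[/eqP -> vQ] | /eqP vp] ev.
  + exists (v %/ d * d); apply/runP => k hk.
    have [->|kv] := eqVneq k v; first by rewrite pos_val setU11.
    rewrite in_setU1 inF; last by arith.
    have -> : k = v %/ d * d + (k - v %/ d * d) by arith.
    by rewrite zeroE ?orbT //; arith.
  + exists v; apply/runP => k hk.
    have [->|kv] := eqVneq k v; first by rewrite pos_val setU11.
    have tQ : (v %/ d).+1 < Q.
      have : v %/ d * d + m < Q.-1 * d by rewrite -ev.
      by rewrite -addnS -mulSnr leq_mul2r /=; arith.
    have := mulQ _ tQ => Qd.
    have ek : k = (v %/ d).+1 * d + (k - v.+1) by rewrite mulSnr; arith.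
    rewrite in_setU1 inF; last by move: Qd; rewrite mulSnr; arith.
    by rewrite ek zeroE; move: Qd; rewrite mulSnr; arith.
  + exists v; apply/runP => k hk.
    have [->|kv] := eqVneq k v; first by rewrite pos_val setU11.
    rewrite -(subnK (_ : n <= k)) ?posDn; last by arith.
    rewrite in_setU1 inF; last by arith.
    have := zeroE 0 (k - n); rewrite mul0n add0n => -> //; arith.
(* An enumeration of missing vertices; [p] is a further one if [0 < s]. The total
   [Q.*2.-1 + (0 < s)] is [f n.+1 - 1]. *)
pose g k := k./2 * d + (m.-1 + odd k).
pose L := map g (iota 0 (Q.*2.-1)) ++ nseq (0 < s) p.
have gz k : k < Q.*2.-1 -> (g k < n) && zero (g k) && ((0 < s) ==> (g k != p)).
  move=> kQ; have := odd_double_half k; rewrite /g /zero; move: k./2 => t.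
  case: (odd k) => /= ek; rewrite modnMDl modn_small; try arith.
    have tQ : t < Q.-1 by arith.
    have h1 : t * d + d <= Q.-1 * d by rewrite -mulSnr leq_mul2r tQ orbT.
    have h2 := mulQ Q.-1 ltac:(arith).
    have -> : m.-1 + 1 = m by arith.
    by rewrite eqxx; arith.
  have h := mulQ t ltac:(arith).
  by rewrite addn0 eqxx; arith.
have g_inj : injective g.
  move=> k l e.
  have eh k' : k' = odd k' + (g k' %/ d).*2.
    rewrite /g divnMDl // divn_small ?addn0 ?odd_double_half //.
    by case: (odd k'); arith.
  have eo k' : odd k' = (g k' %% d == m) :> bool.
    by rewrite modnMDl modn_small; case: (odd k') => /=; arith.
  by rewrite (eh k) (eh l) (eo k) (eo l) e.
have Luniq : uniq L.
  rewrite cat_uniq map_inj_uniq // iota_uniq; apply/andP; split=> //.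
  apply/andP; split; last by case: (0 < s).
  apply/hasPn => x; rewrite mem_nseq lt0b => /andP[s0 /eqP ->].
  apply/mapP => -[k]; rewrite mem_iota => /gz/andP[_ /implyP/(_ s0) + e].
  by rewrite -e eqxx.
have Lz x : x \in L -> (x < n) && zero x.
  rewrite mem_cat => /orP[/mapP[k]|]; first by rewrite mem_iota => /gz/andP[h _] ->.
  by rewrite mem_nseq => /andP[_ /eqP ->]; rewrite leqnn /zero eqxx !orbT.
have Lcard : size L <= #|~: F|.
  have <- : #|map pos L| = size L.
    rewrite -(size_map pos); apply/card_uniqP; rewrite map_inj_in_uniq // => x y.
    move=> /Lz/andP[xn _] /Lz/andP[yn _] /(congr1 val) /=.
    by rewrite !val_pos_small.
  apply/subset_leq_card/subsetP => i /mapP[x /Lz/andP[xn zx] ->].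
  by rewrite inE inF // zx.
have := cardsC F; rewrite card_ord fn.
by move: Lcard; rewrite size_cat size_map size_iota size_nseq; arith.
Qed.
End Facet.

(** * Koszul cocycles and regular sequences *)

Section SeqSubmod.
Local Open Scope ring_scope.
Variables (R : comNzRingType) (M : lmodType R).
Implicit Types (s : seq R) (x y : M).

Lemma seq_submod0 s : seq_submod s (0 : M).
Proof. by exists (fun=> 0); rewrite big1 // => i _; rewrite scaler0. Qed.

Lemma seq_submodD s x y : seq_submod s x -> seq_submod s y -> seq_submod s (x + y).
Proof.
move=> [u ->] [v ->]; exists (fun i => u i + v i); rewrite -big_split.
by apply: eq_bigr => i _; rewrite scalerDr.
Qed.

Lemma seq_submodZ s a x : seq_submod s x -> seq_submod s (a *: x).
Proof.
move=> [u ->]; exists (fun i => a *: u i); rewrite scaler_sumr.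
by apply: eq_bigr => i _; rewrite !scalerA mulrC.
Qed.

Lemma seq_submod_sum s (I : finType) (P : pred I) (F : I -> M) :
  (forall i, P i -> seq_submod s (F i)) -> seq_submod s (\sum_(i | P i) F i).
Proof. by move=> h; apply: big_ind => //; [exact: seq_submod0|exact: seq_submodD]. Qed.

Lemma seq_submod_rcons s a x :
  seq_submod (rcons s a) x <-> exists u v, seq_submod s u /\ x = u + a *: v.
Proof.
split=> [[y ->]|[u [v [[y ->] ->]]]].
  exists (\sum_(i < size s) s`_i *: y i), (y (size s)); split; first by exists y.
  rewrite size_rcons big_ord_recr /= nth_rcons ltnn eqxx; congr (_ + _).
  by apply: eq_bigr => i _; rewrite nth_rcons ltn_ord.
exists (fun i => if (i < size s)%N then y i else v).
rewrite size_rcons big_ord_recr /= nth_rcons ltnn eqxx; congr (_ + _).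
by apply: eq_bigr => i _; rewrite nth_rcons ltn_ord.
Qed.
End SeqSubmod.

(** * The Koszul complex *)

Section Koszul.
Local Open Scope ring_scope.
Variables (n : nat) (R : comNzRingType) (M : lmodType R) (x : 'I_n -> R).
Implicit Types (Y : {set 'I_n}) (z : {set 'I_n} -> M) (i j : 'I_n).

Definition ksign i Y : R := (-1) ^+ #|[set j in Y | (j < i)%N]|.

Lemma ksign_sqr i Y : ksign i Y * ksign i Y = 1.
Proof. by rewrite -expr2 -exprM mulnC exprM sqrrN expr1n expr1n. Qed.

Lemma ksign_swap i j Y : i != j -> i \in Y -> j \in Y ->
  ksign i Y * ksign j (Y :\ i) = - (ksign j Y * ksign i (Y :\ j)).
Proof.
wlog lt : i j / (i < j)%N.
  move=> H ij iY jY; have [lt|lt|/val_inj e] := ltngtP i j.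
  - exact: H.
  - by rewrite (H j i) ?opprK // eq_sym.
  by rewrite e eqxx in ij.
move=> ij iY jY; rewrite /ksign.
have -> : [set k in Y :\ j | (k < i)%N] = [set k in Y | (k < i)%N].
  apply/setP => k; rewrite !inE; case: eqVneq => // -> /=.
  by rewrite ltnNge (ltnW lt) /= andbF.
have -> : [set k in Y | (k < j)%N] = i |: [set k in Y :\ i | (k < j)%N].
  by apply/setP => k; rewrite !inE; case: eqVneq => // ->; rewrite iY lt.
rewrite cardsU1 !inE eqxx /= exprS -mulNr mulN1r opprK mulrC //.
Qed.

(* A cochain gives all degrees of the Koszul complex at once: its value at [Y]
   is the coefficient of the exterior monomial of [Y]. *)
Definition kdiff z Y : M := \sum_(i in Y) (ksign i Y * x i) *: z (Y :\ i).

(** Interior product with the vector [c]. *)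
Definition kcontract (c : 'I_n -> R) z Y : M :=
  \sum_(i in ~: Y) (ksign i (i |: Y) * c i) *: z (i |: Y).

Lemma eq_kdiff z z' Y : (forall i, i \in Y -> z (Y :\ i) = z' (Y :\ i)) ->
  kdiff z Y = kdiff z' Y.
Proof. by move=> h; apply: eq_bigr => i /h ->. Qed.

Lemma kdiffB z z' Y : kdiff (fun A => z A - z' A) Y = kdiff z Y - kdiff z' Y.
Proof. by rewrite /kdiff -sumrB; apply: eq_bigr => i _; rewrite scalerBr. Qed.

Lemma kdiffD z z' Y : kdiff (fun A => z A + z' A) Y = kdiff z Y + kdiff z' Y.
Proof. by rewrite /kdiff -big_split; apply: eq_bigr => i _; rewrite scalerDr. Qed.

Lemma kdiffZ a z Y : kdiff (fun A => a *: z A) Y = a *: kdiff z Y.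
Proof.
by rewrite /kdiff scaler_sumr; apply: eq_bigr => i _; rewrite !scalerA mulrC.
Qed.

Lemma kdiff_kdiff z Y : kdiff (kdiff z) Y = 0.
Proof.
pose F i j := (ksign i Y * x i * (ksign j (Y :\ i) * x j)) *: z (Y :\ i :\ j).
have -> : kdiff (kdiff z) Y =
    \sum_(i in Y) (\sum_(j in Y | (j < i)%N) F i j + \sum_(j in Y | (i < j)%N) F i j).
  apply: eq_bigr => i iY; rewrite scaler_sumr.
  rewrite (bigID (fun j => (j < i)%N)) /=; congr (_ + _).
    apply: eq_big => [j|j _]; last by rewrite scalerA.
    by rewrite !inE -val_eqE /=; case: ltngtP; rewrite ?andbF ?andbT.
  apply: eq_big => [j|j _]; last by rewrite scalerA.
  by rewrite !inE -val_eqE /=; case: ltngtP; rewrite ?andbF ?andbT.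
rewrite big_split /= [X in X + _](exchange_big_dep (mem Y)) //=; last by move=> i j _ /andP[].
rewrite -big_split big1 // => j jY /=.
rewrite (eq_bigl (fun i => (i \in Y) && (j < i)%N)); last first.
  by move=> i /=; rewrite jY.
rewrite -big_split big1 // => i /andP[iY ji] /=; rewrite /F.
have ij : i != j by rewrite -val_eqE /= neq_ltn ji orbT.
have -> : Y :\ j :\ i = Y :\ i :\ j by rewrite !setDDl setUC.
rewrite -scalerDl mulrACA ksign_swap // [X in _ + X]mulrACA mulNr [x i * x j]mulrC.
by rewrite addNr scale0r.
Qed.

(** Cartan's homotopy formula: the terms with [i] in [Y] and [j] outside cancel between the two
    composites, and the diagonal terms remain. *)
Lemma kdiff_kcontract c z Y :
  kdiff (kcontract c z) Y + kcontract c (kdiff z) Y = (\sum_i c i * x i) *: z Y.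
Proof.
pose F i j := (ksign i Y * x i * (ksign j (j |: Y :\ i) * c j)) *: z (j |: Y :\ i).
have -> : kdiff (kcontract c z) Y =
    \sum_(i in Y) ((c i * x i) *: z Y + \sum_(j in ~: Y) F i j).
  apply: eq_bigr => i iY; rewrite scaler_sumr (bigD1 i) ?inE ?eqxx //=.
  rewrite setD1K // scalerA mulrACA ksign_sqr mul1r [x i * _]mulrC; congr (_ + _).
  apply: eq_big => [j|j _]; last by rewrite scalerA.
  by rewrite !inE; case: eqVneq => [->|]; rewrite ?iY ?andbF ?andbT.
have -> : kcontract c (kdiff z) Y =
    \sum_(j in ~: Y) ((c j * x j) *: z Y - \sum_(i in Y) F i j).
  apply: eq_bigr => j; rewrite inE => jY; rewrite scaler_sumr (bigD1 j) ?inE ?eqxx //=.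
  rewrite setU1K // scalerA mulrACA ksign_sqr mul1r; congr (_ + _).
  rewrite -sumrN; apply: eq_big => [i|i].
    by rewrite !inE; case: eqVneq => [->|]; rewrite ?(negbTE jY) ?andbF ?andbT.
  rewrite !inE => /andP[iY ij]; rewrite (negbTE ij) /= in iY.
  have e : (j |: Y) :\ i = j |: Y :\ i.
    by apply/setP => k; rewrite !inE; case: eqVneq => // ->; rewrite (negbTE ij).
  rewrite scalerA /F e -scaleNr; congr (_ *: _).
  rewrite mulrACA [in RHS]mulrACA -mulNr [c j * _]mulrC; congr (_ * _).
  have := @ksign_swap j i (j |: Y); rewrite eq_sym !inE eqxx iY orbT setU1K // e.
  move=> /(_ ij isT isT) h; rewrite -[LHS]mul1r -(ksign_sqr i Y) mulrACA.
  rewrite [ksign i Y * _]mulrC h mulNr [_ * ksign i (j |: Y)]mulrC mulrACA.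
  by rewrite ksign_sqr mul1r [_ * ksign i Y]mulrC.
rewrite !big_split /= sumrN exchange_big /= addrACA subrr addr0 scaler_suml.
by rewrite [RHS](bigID (mem Y)) /=; congr (_ + _); apply: eq_bigl => i; rewrite inE.
Qed.

(* Contracting a Koszul cocycle against an M-regular element of the ideal (x)
   produces a cocycle one degree lower over the quotient by that element, and
   preserves nontriviality; a cocycle cannot be lowered below degree 0. *)
Lemma regular_seq_le_koszul (s : seq R) (e : nat) z :
  {subset s <= ideal_gen x} -> regular_seq M s ->
  (forall A : {set 'I_n}, #|A| != e -> z A = 0) -> (forall Y, kdiff z Y = 0) ->
  ~ (exists y, forall A, z A = kdiff y A) -> (size s <= e)%N.
Proof.
move=> sI [reg _] ze zc znb; rewrite leqNgt; apply/negP => es.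
(* The cochain reached after [i] elements has degree [e - i]; it is a nontrivial cocycle modulo
   these elements. *)
have step (i : nat) : (i <= size s)%N -> exists z' : {set 'I_n} -> M,
    [/\ forall A : {set 'I_n}, (#|A| + i != e)%N -> z' A = 0,
        forall Y, seq_submod (take i s) (kdiff z' Y)
      & ~ exists y, forall A, seq_submod (take i s) (z' A - kdiff y A)].
  elim: i => [_|i IH si].
    exists z; rewrite take0; split=> [A|Y|[y h]].
    - by rewrite addn0 => /ze.
    - by rewrite zc; apply: seq_submod0.
    - apply: znb; exists y => A; have [v] := h A.
      by rewrite big_ord0 => /eqP; rewrite subr_eq0 => /eqP.
  have [z' [z'e z'c z'nb]] := IH (ltnW si).
  have /sI/ideal_genP[c sc] := mem_nth 0 si.
  have hd := kdiff_kcontract c z'; rewrite -sc in hd.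
  exists (kcontract c z'); rewrite (take_nth 0 si); split=> [A hA|Y|[y hy]].
  - apply: big1 => j; rewrite inE => jA; rewrite z'e ?scaler0 //.
    by rewrite cardsU1 jA add1n addSnnS.
  - apply/seq_submod_rcons; exists (- kcontract c (kdiff z') Y), (z' Y).
    split; last by rewrite -hd addrC addrK.
    rewrite -scaleN1r; apply: seq_submodZ; apply: seq_submod_sum => j _.
    exact: seq_submodZ.
  have {hy} hy A : exists uv : M * M, seq_submod (take i s) uv.1 /\
      kcontract c z' A - kdiff y A = uv.1 + s`_i *: uv.2.
    by have /seq_submod_rcons[u [v h]] := hy A; exists (u, v).
  have [uv huv] := fin_all_exists hy.
  (* If the contraction bounds modulo the longer sequence, the homotopy formula puts [s_i] times
     [z'] minus a coboundary into the submodule of the first [i] elements, and regularity cancels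
     [s_i]. *)
  apply: z'nb; exists (fun A => (uv A).2) => A; apply: (reg i si).
  have -> : s`_i *: (z' A - kdiff (fun A => (uv A).2) A) =
      kdiff (fun A => (uv A).1) A + kcontract c (kdiff z') A.
    rewrite scalerBr -hd -kdiffZ.
    have -> : kdiff (kcontract c z') A =
        kdiff (fun A => (uv A).1 + s`_i *: (uv A).2 + kdiff y A) A.
      by apply: eq_kdiff => j _; have [_ <-] := huv (A :\ j); rewrite subrK.
    by rewrite kdiffD kdiff_kdiff addr0 kdiffD addrAC addrK.
  apply: seq_submodD; apply: seq_submod_sum => j _; apply: seq_submodZ => //.
  by have [] := huv (A :\ j).
(* One step below degree 0 the cochain is zero and hence a coboundary. *)
have [z' [z'e _]] := step e.+1 es; case.
exists (fun=> 0) => A; rewrite z'e; last by rewrite gtn_eqF // addnS ltnS leq_addl.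
rewrite sub0r /kdiff big1 ?oppr0; first exact: seq_submod0.
by move=> i _; rewrite scaler0.
Qed.
End Koszul.

(** * Cohomology of sets of subsets *)

Section Cohomology.
Local Open Scope ring_scope.
Variables (n : nat) (K : fieldType).
Implicit Types (P Q : pred {set 'I_n}) (X Y A B : {set 'I_n}) (v : 'I_n).
Implicit Types (b c : {set 'I_n} -> K^o) (j k : nat).
Local Notation d := (kdiff (M := K^o) (fun=> 1 : K)).

Definition convex P := forall X Y Z : {set 'I_n},
  X \subset Y -> Y \subset Z -> P X -> P Z -> P Y.

Definition cochain P j c := forall X, c X != 0 -> P X /\ #|X| = j.

(** The equation is imposed on [P] only: for convex [P] this is the relative cohomology of a pair of
    simplicial complexes. *)
Definition cocycle P j c := cochain P j c /\ forall Y, P Y -> d c Y = 0.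

(* The degree is shifted on the right so that there is nothing below degree 0. *)
Definition coboundary P j c :=
  exists2 b, forall X, b X != 0 -> P X /\ #|X|.+1 = j
           & forall Y, P Y -> d b Y = c Y.

Definition vanishing P j := forall c, cocycle P j c -> coboundary P j c.

Definition nonvanishing P j := exists2 c, cocycle P j c & ~ coboundary P j c.

Definition restrict P c X : K^o := if P X then c X else 0.

Lemma restrict_supp P c X : restrict P c X != 0 -> P X.
Proof. by rewrite /restrict; case: ifP => //; rewrite eqxx. Qed.

Lemma eq_nonvanishing P Q j : P =1 Q -> nonvanishing P j -> nonvanishing Q j.
Proof. by move=> /funext ->. Qed.

Lemma diff0 c Y : (forall i, i \in Y -> c (Y :\ i) = 0) -> d c Y = 0.
Proof. by move=> h; apply: big1 => i iY; rewrite h // scaler0. Qed.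

(** Convexity makes the truncated differential square to zero: a face of [Y] where [d c] is nonzero
    lies between two members of [P]. *)
Lemma diff_restrict P c Y : convex P -> (forall X, c X != 0 -> P X) -> P Y ->
  d (restrict P (d c)) Y = 0.
Proof.
move=> cP cs PY; rewrite -[RHS](kdiff_kdiff (fun=> 1 : K) c Y).
apply: eq_kdiff => i iY; rewrite /restrict; case: ifP => // /negP nP.
rewrite diff0 // => k _; apply/eqP; apply: contra_notT nP => /cs PX.
by apply: cP PX PY; rewrite subD1set.
Qed.

Lemma diff_size c j Y : (forall X, c X != 0 -> #|X|.+1 = j) -> d c Y != 0 -> #|Y| = j.
Proof.
move=> cs; apply: contra_neq_eq => Yj; apply: diff0 => i iY.
apply/eqP; apply: contra_neqT Yj => /cs; by rewrite (cardsD1 i Y) iY.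
Qed.

Lemma coboundary_ungraded P j c b : cochain P j c ->
  (forall X, b X != 0 -> P X) -> (forall Y, P Y -> d b Y = c Y) -> coboundary P j c.
Proof.
move=> cs bs hb; exists (restrict (fun X => #|X|.+1 == j) b) => [X|Y PY].
  by rewrite /restrict; case: ifP => [/eqP <- /bs|]; rewrite ?eqxx.
have e i : i \in Y -> #|Y :\ i|.+1 = #|Y| by move=> iY; rewrite (cardsD1 i Y) iY.
have [Yj|Yj] := eqVneq #|Y| j.
  rewrite -hb //; apply: eq_kdiff => i iY; by rewrite /restrict e // Yj eqxx.
rewrite diff0 => [|i iY]; last by rewrite /restrict e // (negbTE Yj).
by apply/esym/eqP; apply: contra_neqT Yj => /cs[].
Qed.

Section Split.
Local Open Scope ring_scope.
Variables (P : pred {set 'I_n}) (v : 'I_n).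
Hypothesis convP : convex P.
Let P0 X := P X && (v \notin X).
Let P1 X := P X && (v \in X).

Let diff1 c Y : (forall X, c X != 0 -> v \in X) -> v \notin Y -> d c Y = 0.
Proof.
move=> cs vY; apply: diff0 => i _; apply/eqP; apply: contraNT vY => /cs.
by rewrite in_setD1 => /andP[].
Qed.

(** Part of the long exact sequence: cochains on sets containing [v] form a subcomplex, those on the
    other sets the quotient. Subtracting the coboundary of a primitive over [P0] moves the cocycle
    into [P1]. *)
Lemma vanishing_split j : vanishing P0 j -> vanishing P1 j -> vanishing P j.
Proof.
move=> h0 h1 c [cs cz]; have [|b0 b0s b0d] := h0 (restrict P0 c).
  split=> [X|Y /andP[PY vY]].
    by move=> h; split; [exact: restrict_supp h|move: h; rewrite /restrict; case: ifP => [_ /cs[]//|]; rewrite eqxx].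
  rewrite -[RHS](cz Y PY); apply: eq_kdiff => i iY; rewrite /restrict /P0.
  rewrite in_setD1 (negbTE vY) andbF andbT; case: ifP => // /negP nP.
  by apply/esym/eqP; apply: contra_notT nP => /cs[].
pose c1 X := c X - restrict P (d b0) X.
have b0P X : b0 X != 0 -> P X by move/b0s => -[/andP[]].
have c1P X : c1 X != 0 -> P X.
  by rewrite /c1 /restrict; case: ifP => // nP; rewrite subr0 => /cs[]; rewrite nP.
have c1v X : c1 X != 0 -> v \in X.
  move=> h; have PX := c1P _ h; apply: contraNT h => vX.
  have P0X : P0 X by rewrite /P0 PX.
  by rewrite /c1 /restrict PX b0d // /restrict P0X subrr.
have [|b1 b1s b1d] := h1 c1.
  split=> [X h|Y /andP[PY vY]].
    split; first by rewrite /P1 c1P ?c1v.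
    have PX := c1P _ h; move: h; rewrite /c1 /restrict PX.
    have [->|/cs[_ //]] := eqVneq (c X) 0.
    by rewrite sub0r oppr_eq0; apply: diff_size => Z /b0s[].
  by rewrite kdiffB cz // diff_restrict // subrr.
exists (fun X => b0 X + b1 X) => [X|Y PY].
  have [-> | /b0s[/andP[PX _] sX] _] := eqVneq (b0 X) 0; last by [].
  by rewrite add0r => /b1s[/andP[PX _]].
rewrite kdiffD; have [vY|vY] := boolP (v \in Y).
  by rewrite b1d /P1 ?PY // /c1 /restrict PY addrC subrK.
rewrite [X in _ + X]diff1 // => [|X /b1s[/andP[]]//].
have P0Y : P0 Y by rewrite /P0 PY.
by rewrite addr0 b0d // /restrict P0Y.
Qed.

(** The connecting map sends the class of [z] to that of [w], which is zero by hypothesis; a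
    primitive of [w] corrects [z] to a cocycle on [P]. *)
Lemma nonvanishing_split0 j :
  nonvanishing P0 j -> vanishing P1 j.+1 -> nonvanishing P j.
Proof.
move=> [z [zs zc] znb] h1.
have zP X : z X != 0 -> P X by move=> /zs[/andP[]].
pose w := restrict P (d z).
have wv X : w X != 0 -> v \in X.
  rewrite /w /restrict; case: ifP => [PX|]; last by rewrite eqxx.
  by apply: contraNT => vX; rewrite zc // /P0 PX.
have [|b bs bd] := h1 w.
  split=> [X h|Y /andP[PY _]]; last exact: diff_restrict.
  split; first by rewrite /P1 (restrict_supp h) wv.
  move: h; rewrite /w /restrict; case: ifP => [_|]; last by rewrite eqxx.
  by apply: diff_size => Z /zs[_ ->].
have bd0 Y : v \notin Y -> d b Y = 0 by apply: diff1 => X /bs[/andP[]].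
have b0 Y : v \notin Y -> b Y = 0.
  by move=> vY; apply/eqP; apply: contraNT vY => /bs[/andP[]].
exists (fun X => z X - b X).
  split=> [X|Y PY].
    have [->|/zs[/andP[PX _] sX]] := eqVneq (z X) 0; last by [].
    by rewrite sub0r oppr_eq0 => /bs[/andP[PX _] [sX]].
  rewrite kdiffB; have [vY|vY] := boolP (v \in Y).
    by rewrite bd /P1 ?PY // /w /restrict PY subrr.
  by rewrite zc /P0 ?PY // bd0 // subrr.
case=> y ys yd; apply: znb; apply: (@coboundary_ungraded _ _ _ (restrict P0 y)) => //.
  by move=> X /restrict_supp.
move=> Y /[dup] P0Y /andP[PY vY]; rewrite -[z Y]subr0 -(b0 Y vY) -yd //.
apply: eq_kdiff => i iY; rewrite /restrict /P0 in_setD1 (negbTE vY) andbF andbT.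
by case: ifP => // /negP nP; apply/esym/eqP; apply: contra_notT nP => /ys[].
Qed.

(** A primitive of [z] over [P] restricts to a cocycle on [P0]. As this is a coboundary, the
    primitive can be changed into one supported on [P1]. *)
Lemma nonvanishing_split1 j : (forall i, i.+1 = j -> vanishing P0 i) ->
  nonvanishing P1 j -> nonvanishing P j.
Proof.
move=> h0 [z [zs zc] znb].
have z0 Y : v \notin Y -> z Y = 0.
  by move=> vY; apply/eqP; apply: contraNT vY => /zs[/andP[]].
exists z.
  split=> [X /zs[/andP[]]//|Y PY]; have [vY|vY] := boolP (v \in Y).
    by rewrite zc // /P1 PY.
  by apply: diff1 => // X /zs[/andP[]].
case=> y ys yd; have yP X : y X != 0 -> P X by move=> /ys[].
apply: znb; case: j h0 zs ys => [|i] h0 zs ys.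
  by exists y => [X /ys[]|Y /andP[PY _]]; [|exact: yd].
have [|b bs bd] := h0 i erefl (restrict P0 y).
  split=> [X h|Y /andP[PY vY]].
    split; first exact: restrict_supp h.
    by move: h; rewrite /restrict; case: ifP => [_ /ys[_ []]//|]; rewrite eqxx.
  rewrite -[RHS](z0 Y vY) -yd //; apply: eq_kdiff => k kY.
  rewrite /restrict /P0 in_setD1 (negbTE vY) andbF andbT.
  by case: ifP => // /negP nP; apply/esym/eqP; apply: contra_notT nP => /yP.
have bP X : b X != 0 -> P X by move/bs => -[/andP[]].
pose y1 X := y X - restrict P (d b) X.
have y1P X : y1 X != 0 -> P X.
  by rewrite /y1 /restrict; case: ifP => // nP; rewrite subr0 => /yP; rewrite nP.
have y1v X : y1 X != 0 -> v \in X.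
  move=> h; have PX := y1P _ h; apply: contraNT h => vX.
  have P0X : P0 X by rewrite /P0 PX.
  by rewrite /y1 /restrict PX bd // /restrict P0X subrr.
apply: (@coboundary_ungraded _ _ _ y1) => // [X h|Y /andP[PY _]].
  by rewrite /P1 y1P ?y1v.
by rewrite kdiffB diff_restrict // subr0 yd.
Qed.
End Split.

(** Contraction with the indicator of [v] is a homotopy between the identity and zero; it respects
    supports because [P] ignores [v]. *)
Lemma vanishing_cone P v j :
  (forall X, P X = P (v |: X)) -> vanishing P j.
Proof.
move=> cone c [cs cz].
have hP X : P (X :\ v) = P X.
  have [vX|vX] := boolP (v \in X); first by rewrite [LHS]cone setD1K.
  by rewrite (setDidPl _) // disjoint_sym disjoints1.
pose e i : K := (i == v)%:R.
apply: (@coboundary_ungraded _ _ _ (kcontract (M := K^o) e c)) => // [X|Y PY].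
  apply: contra_neqT => nP; apply: big1 => i; rewrite inE /e => iX.
  have [->|] := eqVneq i v; last by rewrite mulr0 scale0r.
  suff -> : c (v |: X) = 0 by rewrite scaler0.
  by apply/eqP; apply: contraNT nP => /cs[]; rewrite -cone.
have /(congr1 (fun u => u - kcontract (M := K^o) e (d c) Y)) :=
  kdiff_kcontract (fun=> 1 : K) e c Y.
rewrite addrK => ->.
rewrite [X in _ - X]big1 ?subr0 => [|i].
  rewrite (bigD1 v) //= /e eqxx mulr1 big1 ?addr0 ?scale1r // => i /negbTE ->.
  by rewrite mul0r.
rewrite inE /e => iY; have [->|] := eqVneq i v; last by rewrite mulr0 scale0r.
by rewrite cz ?scaler0 // -cone.
Qed.

Lemma vanishing_empty P j : (forall X, ~~ P X) -> vanishing P j.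
Proof.
move=> nP c _; exists (fun=> 0) => [X|Y PY]; first by rewrite /= eqxx.
by have := nP Y; rewrite PY.
Qed.

Lemma vanishing_single A j : #|A| != j -> vanishing (pred1 A) j.
Proof.
move=> Aj c [cs _]; exists (fun=> 0) => [X|Y /= /eqP ->]; first by rewrite /= eqxx.
rewrite diff0 //; apply/esym/eqP; apply: contra_neqT Aj.
by move=> /cs[].
Qed.

Lemma nonvanishing_single A : nonvanishing (pred1 A) #|A|.
Proof.
pose c X : K^o := (X == A)%:R.
have cA X : c X != 0 -> X = A by rewrite /c; case: (X =P A) => // _; rewrite mulr0n eqxx.
have dA b : (forall X, b X != 0 -> X = A) -> d b A = 0.
  move=> bs; apply: diff0 => i iA; apply/eqP.
  by apply: contraTT iA => /bs <-; rewrite !inE eqxx.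
exists c.
  split=> [X /cA ->|Y /= /eqP ->]; last exact: dA.
  by rewrite /= eqxx.
case=> b bs /(_ A (eqxx A)); rewrite dA => [|X /bs[/eqP]//].
by rewrite /c eqxx => /eqP; rewrite eq_sym oner_eq0.
Qed.

(* The connecting map of the two parts of the Boolean lattice, which is acyclic. *)
Lemma nonvanishing_compl P j v : (forall X Y, X \subset Y -> P Y -> P X) ->
  nonvanishing P j -> nonvanishing (predC P) j.+1.
Proof.
move=> down [z [zs zc] znb]; exists (d z).
  split=> [X h|Y _]; last exact: kdiff_kdiff.
  split; first by apply: contraNT h => /= /negPn /zc ->.
  by apply: diff_size h => Z /zs[_ ->].
case=> y ys yd; apply: znb.
have [|b bs bd] := @vanishing_cone predT v j (fun=> erefl) (fun X => z X - y X).
  split=> [X|Y _].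
    have [->|/zs[_ ->]//] := eqVneq (z X) 0.
    by rewrite sub0r oppr_eq0 => /ys[_ []].
  rewrite kdiffB; have [PY|PY] := boolP (P Y); last by rewrite yd // subrr.
  rewrite zc // diff0 ?subr0 // => i iY; apply/eqP.
  apply: contraTT PY => /ys[/= nP _]; apply: contra nP.
  by apply: down; rewrite subD1set.
apply: (@coboundary_ungraded _ _ _ (restrict P b)) => // [X /restrict_supp //|Y PY].
have -> : z Y = z Y - y Y.
  suff -> : y Y = 0 by rewrite subr0.
  by apply/eqP; apply: contraTT PY => /ys[].
rewrite -bd //; apply: eq_kdiff => i iY.
by rewrite /restrict (down _ Y) // subD1set.
Qed.

(* The flag [b] only records a positive answer: [false] means unknown. *)
Definition concentrated (b : bool) k P :=
  (forall j, j != k -> vanishing P j) /\ (b -> nonvanishing P k).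

Lemma eq_concentrated (b : bool) k P Q : P =1 Q -> concentrated b k P -> concentrated b k Q.
Proof. by move=> /funext ->. Qed.

Lemma concentrated_weak (b b' : bool) k P :
  (b' -> b) -> concentrated b k P -> concentrated b' k P.
Proof. by move=> hb [h1 h2]; split=> // /hb. Qed.

(** Since both parts live in the same degree [k], the connecting maps vanish and no class of either
    part is lost. *)
Lemma concentrated_split v (b0 b1 : bool) k P : convex P ->
  concentrated b0 k (fun X => P X && (v \notin X)) ->
  concentrated b1 k (fun X => P X && (v \in X)) -> concentrated (b0 || b1) k P.
Proof.
move=> cP [van0 nv0] [van1 nv1]; split=> [j jk|].
  by apply: vanishing_split; [exact: cP|exact: van0|exact: van1].
case: b0 nv0 => [/(_ isT) nv0 _|_ /= /nv1{}nv1].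
  by apply: nonvanishing_split0 nv0 _ => //; apply: van1; rewrite gtn_eqF.
by apply: nonvanishing_split1 nv1 => // i ik; apply: van0; rewrite -ik ltn_eqF.
Qed.

Lemma concentrated_cone v k P : (forall X, P X = P (v |: X)) -> concentrated false k P.
Proof. by move=> h; split=> // j _; apply: vanishing_cone h. Qed.

Lemma concentrated_empty k P : (forall X, ~~ P X) -> concentrated false k P.
Proof. by move=> h; split=> // j _; apply: vanishing_empty. Qed.

Lemma concentrated_single A : concentrated true #|A| (pred1 A).
Proof.
split=> [j|_]; last exact: nonvanishing_single.
by rewrite eq_sym; apply: vanishing_single.
Qed.
End Cohomology.

(** * Cohomology of run-free sets on a path *)

Section PathCohomology.
Variables (p m : nat) (K : fieldType).
Local Notation n := p.+1.
Local Notation f := (path_zeros m).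
Local Notation pos := (@pos p).
Local Notation block := (@block p).
Implicit Types (A B X : {set 'I_n}).
Variable Q : pred {set 'I_n}.
Hypothesis downQ : forall X Y : {set 'I_n}, X \subset Y -> Q Y -> Q X.

Definition node A B X := interval A B X && Q X.
Local Notation concentrated := (concentrated K).

Lemma convex_node A B : convex (node A B).
Proof.
move=> X Y Z XY YZ /andP[/andP[AX _] _] /andP[/andP[_ ZB] QZ].
by rewrite /node /interval (subset_trans AX) // (subset_trans YZ) // (downQ YZ).
Qed.

Lemma concentrated_node_split v (b0 b1 : bool) k A B : v \in B -> v \notin A ->
  concentrated b0 k (node A (B :\ v)) -> concentrated b1 k (node (v |: A) B) ->
  concentrated (b0 || b1) k (node A B).
Proof.
move=> vB vA h0 h1; apply: (@concentrated_split _ _ v); first exact: convex_node.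
  apply: eq_concentrated h0 => X; rewrite /node /interval subsetD1.
  by case: (v \notin X); rewrite !(andbT, andbF).
apply: eq_concentrated h1 => X; rewrite /node /interval subUset sub1set.
by case: (v \in X); rewrite !(andbT, andbF).
Qed.

Lemma concentrated_node_cone v k A B : v \in B -> v \notin A ->
  (forall X, interval A B X -> Q X = Q (v |: X)) -> concentrated false k (node A B).
Proof.
move=> vB vA h; apply: (@concentrated_cone _ _ v) => X.
have e : interval A B (v |: X) = interval A B X.
  rewrite /interval subUset sub1set vB /=; congr (_ && _).
  apply/subsetP/subsetP => s i iA; last by rewrite in_setU s // orbT.
  have := s i iA; rewrite !inE; case: eqVneq => // iv _.
  by rewrite -iv iA in vA.
by rewrite /node e; have [/h ->|] := boolP (interval A B X).
Qed.

Lemma concentrated_read (b : nat -> bool) b' k L A B o :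
  o + L <= n -> free_block A B o L ->
  (forall a, a < L ->
    concentrated (b a) k (node (A :|: block o a) (B :\ pos (o + a)))) ->
  concentrated b' k (node (A :|: block o L) B) ->
  concentrated (has b (iota 0 L) || b') k (node A B).
Proof.
move=> h /(free_blockP _ _ h) hf; elim: L b' h hf => [|L IH] b' h hf h0 h1.
  by rewrite block0 setU0 in h1.
have -> : has b (iota 0 L.+1) || b' = has b (iota 0 L) || (b L || b').
  by rewrite -{1}addn1 iotaD has_cat /= add0n orbF orbA.
apply: IH => [|k' hk|a ha|]; [arith|by apply: hf; arith|by apply: h0; arith|].
have /andP[kB kA] := hf (o + L) ltac:(arith).
apply: (@concentrated_node_split (pos (o + L))) => //.
- by rewrite in_setU negb_or kA pos_block; arith.
- by apply: h0.
by rewrite setUCA -blockS //; arith.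
Qed.

Lemma concentrated_read_back (b : nat -> bool) b' k L A B o :
  o + L <= n -> free_block A B o L ->
  (forall a, a < L -> concentrated (b a) k
    (node (A :|: block (o + a).+1 (L - a.+1)) (B :\ pos (o + a)))) ->
  concentrated b' k (node (A :|: block o L) B) ->
  concentrated (has b (iota 0 L) || b') k (node A B).
Proof.
move=> h /(free_blockP _ _ h) hf; elim: L o b b' h hf => [|L IH] o b b' h hf h0 h1.
  by rewrite block0 setU0 in h1.
have -> : has b (iota 0 L.+1) || b' = has (b \o succn) (iota 0 L) || (b 0 || b').
  have -> : iota 0 L.+1 = 0 :: map succn (iota 0 L).
    by rewrite /= -[1]addn0 iotaDl; congr (_ :: _); apply: eq_map.
  by rewrite /= has_map orbCA orbA.
apply: (IH o.+1) => [|k' hk|a ha|]; [arith|by apply: hf; arith| |].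
  by rewrite addSnnS; have := h0 a.+1 ltac:(arith); rewrite subSS.
have /andP[kB kA] := hf o ltac:(arith).
apply: (@concentrated_node_split (pos o)) => //.
- by rewrite in_setU negb_or kA pos_block; arith.
- by have := h0 0 ltac:(arith); rewrite addn0 subn1.
by rewrite setUCA -block_Sl //; arith.
Qed.

Lemma has_false (s : seq nat) : has (fun=> false) s = false.
Proof. by elim: s. Qed.

(** Fewer than [m] vertices follow the missing [o + u], and the initial run of length [m - h] stops
    short of the last vertex, so the latter is irrelevant. *)
Lemma norun_after_cone h X o N u : o + N <= n -> u.+1 < N -> N <= u + m ->
  m - h < N -> pos (o + u) \notin X ->
  norun_after m h X o N = norun_after m h (pos (o + N.-1) |: X) o N.
Proof.
move=> oN uN Nu hN zX; have agree i : o <= i < o + N.-1 ->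
    (pos i \in X) = (pos i \in pos (o + N.-1) |: X).
  by move=> hi; rewrite in_setU1 pos_eq ?ltn_eqF //; arith.
rewrite /norun_after; congr (_ && ~~ (_ && _)); last first.
  by apply: eq_run => i hi; apply: agree; arith.
rewrite !(norun_split m (a := u) (N := N)) -?agree //; try arith.
congr (_ && _); first by apply: eq_norun => i hi; apply: agree; arith.
by rewrite !norun_small //; arith.
Qed.

Hypothesis m_gt0 : 0 < m.

(** If a vertex is missing among the [m - 1] before the last one, the last vertex is a cone point.
    Otherwise the vertices on both sides of these [m - 1] must be missing: [m.+1] vertices disappear
    and the degree grows by [m - 1]. At the end, apart from cones, a single set is left for [N = 0]
    and for [N = m - h], and none for other [N <= m]. Hence [k] is prescribed for these two residues
    only. *)
Lemma path_concentrated N h o A B k : h < m -> o + N <= n -> A \subset B ->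
  B :\: A = block o N ->
  (forall X, interval A B X -> Q X = norun_after m h X o N) ->
  (N %% m.+1 = 0 -> k = #|A| + N %/ m.+1 * m.-1) ->
  (N %% m.+1 = m - h -> k = #|A| + N %/ m.+1 * m.-1 + (m - h).-1) ->
  concentrated ((N %% m.+1 == 0) || (N %% m.+1 == m - h)) k (node A B).
Proof.
have [N0] := ubnP N; elim: N0 N h o A B => // N0 IH N h o A B NN0.
move=> hm oN AB eBA hQ k0 k1.
have fr : free_block A B o N by rewrite /free_block eBA.
have hf := free_blockP _ _ oN fr.
have inBA i : (i \notin A) && (i \in B) = (o <= i < o + N).
  by move/setP: eBA => /(_ i); rewrite !inE.
have [mN|Nm] := ltnP m N.
  pose N' := N - m.+1; have eN : N = N' + m.+1 by rewrite /N'; arith.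
  have [v vE] : exists v, v = pos (o + N.-1) by exists (pos (o + N.-1)).
  have vN : v = o + N.-1 :> nat by rewrite vE val_pos_small //; arith.
  have /andP[vB vA0] : (v \in B) && (v \notin A) by rewrite vE; apply: hf; arith.
  rewrite -[X in concentrated X](orFb) -(has_false (iota 0 m.-1)).
  apply: (@concentrated_read _ _ _ _ _ _ (o + (N - m))) => [|||]; first by arith.
  - by apply/free_blockP => [|i hi]; [arith|apply: hf; arith].
  - move=> a ha; apply: (@concentrated_node_cone v).
    + by rewrite in_setD1 vB -val_eqE /= vN val_pos_small; arith.
    + by rewrite in_setU (negbTE vA0) inE vN; arith.
    + move=> X; rewrite /interval subUset subsetD1 => /andP[/andP[AX _] /andP[XB zX]].
      rewrite !hQ; [|by rewrite /interval (subset_trans AX) ?subsetU1 // subUset sub1set vB|by rewrite /interval AX].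
      by rewrite (@norun_after_cone h X o N (N - m + a)) ?vE ?addnA //; arith.
  set A1 := A :|: _.
  have vA : v \notin A1 by rewrite in_setU (negbTE vA0) inE vN; arith.
  have runX X : A1 \subset X -> run X (o + (N - m)) m.-1.
    by rewrite subUset -run_block => [/andP[]|]; arith.
  have A1A X : A1 \subset X -> A \subset X by rewrite subUset => /andP[].
  rewrite -[X in concentrated X]orbF; apply: (@concentrated_node_split v) => //; last first.
    apply: concentrated_empty => X; apply/negP => /andP[/andP[]].
    rewrite subUset sub1set => /andP[vX A1X] XB; rewrite hQ ?/interval ?A1A //.
    case/andP => /norunP/(_ (o + (N - m))) nr _; case/negP: (nr ltac:(arith) ltac:(arith)).
    have /runP r := runX X A1X; apply/runP => i hi.
    have [->|ne] := eqVneq i (o + N.-1); first by rewrite -vE.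
    by apply: r; arith.
  have [w wE] : exists w, w = pos (o + N') by exists (pos (o + N')).
  have wN : w = o + N' :> nat by rewrite wE val_pos_small //; arith.
  have /andP[wB0 wA0] : (w \in B) && (w \notin A) by rewrite wE; apply: hf; arith.
  have wB : w \in B :\ v by rewrite in_setD1 wB0 -val_eqE /= vN wN; arith.
  have wA : w \notin A1 by rewrite in_setU (negbTE wA0) inE wN; arith.
  rewrite -[X in concentrated X]orbF; apply: (@concentrated_node_split w) => //; last first.
    apply: concentrated_empty => X; apply/negP => /andP[/andP[]].
    rewrite subUset sub1set => /andP[wX A1X]; rewrite subsetD1 => /andP[XB _].
    rewrite hQ ?/interval ?A1A //.
    case/andP => /norunP/(_ (o + N')) nr _; case/negP: (nr ltac:(arith) ltac:(arith)).
    have /runP r := runX X A1X; apply/runP => i hi.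
    have [->|ne] := eqVneq i (o + N'); first by rewrite -wE.
    by apply: r; arith.
  have cA1 : #|A1| = #|A| + m.-1.
    rewrite cardsU card_block; last by arith.
    rewrite (_ : _ :&: _ = set0) ?cards0 ?subn0 //; apply/setP => i; rewrite !inE.
    by have := inBA i; case: (i \in A); case: (i \in B) => //=; arith.
  have dN : N %/ m.+1 = (N' %/ m.+1).+1 by rewrite eN divnDr ?divnn ?addn1.
  have rN : N %% m.+1 = N' %% m.+1 by rewrite eN modnDr.
  rewrite rN; apply: (IH N' h o) => //; try arith.
  - rewrite !subsetD1 vA wA !andbT subUset AB; apply/subsetP => i; rewrite inE => hi.
    by have := inBA i; case: (i \in B); rewrite ?andbF //; arith.
  - apply/setP => i; rewrite /A1 !inE -!val_eqE /= vN wN.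
    by have := inBA i; case: (i \in A); case: (i \in B) => //=; arith.
  - move=> X /andP[A1X]; rewrite !subsetD1 => /andP[/andP[XB vX] wX].
    rewrite vE wE in vX wX; rewrite hQ ?/interval ?A1A // /norun_after.
    rewrite (norun_split m (a := N') (N := N)) //; last by arith.
    rewrite (norun_split m (a := m.-1) (N := N - N'.+1)); last first.
    + by have -> : (o + N').+1 + m.-1 = o + N.-1 by arith.
    + by arith.
    rewrite [norun m X (o + N').+1 _]norun_small; last by arith.
    rewrite [norun m X _ (N - N'.+1 - _)]norun_small ?andbT; last by arith.
    congr (_ && ~~ _); have [le|lt] := leqP (m - h) N'.
      by rewrite (leq_trans le) //; arith.
    rewrite /= (_ : run X o (m - h) = false) ?andbF //.
    by apply/negP => /runP/(_ (o + N')) r; rewrite r // in wX; arith.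
  - by rewrite -rN => /k0 ->; rewrite cA1 dN mulSn; arith.
  - by rewrite -rN => /k1 ->; rewrite cA1 dN mulSn; arith.
have divN : N %/ m.+1 = 0 by rewrite divn_small.
have modN : N %% m.+1 = N by rewrite modn_small.
rewrite divN modN mul0n addn0 in k0 k1 *.
have [N0'|Npos] : N = 0 \/ 0 < N by arith.
  have eAB : B = A.
    apply/setP => i; apply/idP/idP => [iB|]; last exact: (subsetP AB).
    by have := inBA i; rewrite iB andbT N0'; case: (i \in A) => //=; arith.
  rewrite N0' eqxx /= k0 //.
  apply: eq_concentrated (concentrated_single K A) => X.
  rewrite /node /= /interval; apply/eqP/andP => [->|[/andP[h1 h2] _]].
    by rewrite subxx eAB subxx hQ ?norun_afterN ?/interval ?subxx ?eAB ?subxx //; arith.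
  by apply/eqP; rewrite eqEsubset -{1}eAB h1 h2.
have [v vE] : exists v, v = pos (o + N.-1) by exists (pos (o + N.-1)).
have vN : v = o + N.-1 :> nat by rewrite vE val_pos_small //; arith.
have /andP[vB vA] : (v \in B) && (v \notin A) by rewrite vE; apply: hf; arith.
have intv X : interval A B X -> interval A B (v |: X).
  move=> /andP[AX XB]; apply/andP; split; first by rewrite (subset_trans AX) ?subsetU1.
  by rewrite subUset sub1set vB.
have [Nh|[hN|eN]] : N < m - h \/ m - h < N \/ N = m - h by arith.
- rewrite (_ : _ || _ = false); last by arith.
  apply: (@concentrated_node_cone v) => // X hX.
  by rewrite !hQ ?norun_afterN ?intv.
- rewrite (_ : _ || _ = false); last by arith.
  rewrite (_ : false = has (fun=> false) (iota 0 (m - h)) || false); last first.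
    by rewrite has_false.
  apply: (@concentrated_read _ _ _ _ _ _ o) => [|||]; first by arith.
  + by apply/free_blockP => [|i hi]; [arith|apply: hf; arith].
  + move=> a ha; apply: (@concentrated_node_cone v).
    * by rewrite in_setD1 vB -val_eqE /= vN val_pos_small; arith.
    * by rewrite in_setU (negbTE vA) inE vN; arith.
    * move=> X; rewrite /interval subUset subsetD1 => /andP[/andP[AX _] /andP[XB zX]].
      rewrite !hQ ?intv ?/interval ?AX //.
      by rewrite (@norun_after_cone h X o N a) ?vE //; arith.
  apply: concentrated_empty => X; apply/negP => /andP[/andP[]].
  rewrite subUset -run_block => [/andP[AX rX] XB|]; last by arith.
  by rewrite hQ ?/interval ?AX // /norun_after rX (ltnW hN) andbF.
rewrite -eN eqxx orbT in k1 *.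
rewrite -[X in concentrated X](orFb) -(has_false (iota 0 N.-1)).
apply: (@concentrated_read _ _ _ _ _ _ o) => [|||]; first by arith.
- by apply/free_blockP => [|i hi]; [arith|apply: hf; arith].
- move=> a ha; apply: (@concentrated_node_cone v).
  + by rewrite in_setD1 vB -val_eqE /= vN val_pos_small; arith.
  + by rewrite in_setU (negbTE vA) inE vN; arith.
  + move=> X; rewrite /interval subUset subsetD1 => /andP[/andP[AX _] /andP[XB zX]].
    rewrite !hQ ?intv ?/interval ?AX //.
    rewrite !(@norun_after_zero p m h _ o N a) ?norun_small //; try arith.
    by rewrite in_setU1 negb_or zX andbT -val_eqE /= vN val_pos_small; arith.
set A1 := A :|: _.
have vA1 : v \notin A1 by rewrite in_setU (negbTE vA) inE vN; arith.
have A1A X : A1 \subset X -> A \subset X by rewrite subUset => /andP[].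
rewrite -[X in concentrated X]orbF; apply: (@concentrated_node_split v) => //; last first.
  apply: concentrated_empty => X; apply/negP => /andP[/andP[]].
  rewrite subUset sub1set => /andP[vX A1X] XB; rewrite hQ ?/interval ?A1A //.
  case/andP => _; rewrite -eN leqnn /= => /negP; apply.
  move: A1X; rewrite subUset -run_block => [/andP[_ /runP r]|]; last by arith.
  apply/runP => i hi; have [->|ne] := eqVneq i (o + N.-1); first by rewrite -vE.
  by apply: r; arith.
have eA1 : B :\ v = A1.
  apply/setP => i; rewrite /A1 !inE -val_eqE /= vN.
  have := inBA i; have /implyP := subsetP AB i.
  by case: (i \in A); case: (i \in B) => //=; arith.
have cA1 : #|A1| = k.
  rewrite k1 // cardsU card_block; last by arith.
  rewrite (_ : _ :&: _ = set0) ?cards0 ?subn0 //; apply/setP => i; rewrite !inE.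
  by have := inBA i; case: (i \in A); case: (i \in B) => //=; arith.
rewrite -cA1; apply: eq_concentrated (concentrated_single K A1) => X.
rewrite /node /= /interval eA1; apply/eqP/andP => [->|[/andP[h1 h2] _]]; last first.
  by apply/eqP; rewrite eqEsubset h1 h2.
rewrite subxx; split=> //.
have A1B : A1 \subset B by rewrite -eA1 subD1set.
rewrite hQ ?/interval ?A1A ?A1B // /norun_after; apply/andP; split.
  rewrite (norun_split m (a := N.-1) (N := N)) ?norun_small -?vE //; arith.
rewrite negb_and; apply/orP; right; apply/negP => /runP/(_ (o + N.-1)) r.
rewrite -vE (negbTE vA1) in r; by have := r ltac:(arith).
Qed.
End PathCohomology.

(** * Cohomology of run-free sets on the cycle *)

Section CycleCohomology.
Variables (p m : nat) (K : fieldType).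
Local Notation n := p.+1.
Local Notation f := (path_zeros m).
Local Notation pos := (@pos p).
Local Notation block := (@block p).
Implicit Types (A B X : {set 'I_n}).
Hypothesis m_gt0 : 0 < m.
Hypothesis m_lt_n : m < n.

(** All branches that are not acyclic agree in degree: residue 0 means n = q(m + 1) + h + 1 and
    gives h + q(m - 1), residue m - h means n = (q + 1)(m + 1) and gives (q + 1)(m - 1); both are
    [n - f n]. *)
Lemma cycle_concentrated :
  concentrated K true (n - f n) (fun X : {set 'I_n} => ~~ has_run m X).
Proof.
set Q := fun X => _.
have downQ (X Y : {set 'I_n}) : X \subset Y -> Q Y -> Q X by move=> XY; apply/contra/has_runS.
have h0 : (n - m) + m = n by rewrite subnK // ltnW.
have fr : @free_block p set0 setT (n - m) m.
  by apply/free_blockP => [|k hk]; [arith|rewrite !inE].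
pose b a := let h := m - a.+1 in let N := n - h.+1 in
  (N %% m.+1 == 0) || (N %% m.+1 == m - h).
apply: (@eq_concentrated _ _ _ _ (node Q set0 setT)) => [X|].
  by rewrite /node /interval sub0set subsetT.
apply: (@concentrated_weak _ _ (has b (iota 0 m) || false)) => [_|].
  rewrite orbF; have [q [r [rm en _]]] := path_zerosP m n.
  (* A branch with cohomology: [h = r - 1] leaves a path of residue 0; for [r = 0], [h = 0] leaves
     one of residue [m]. *)
  apply/hasP; exists (if r is r'.+1 then m - r'.+1 else m.-1).
    by rewrite mem_iota; case: r rm {en} => [|r] rm; arith.
  rewrite /b; case: r rm en => [|r] rm en.
    case: q en => [|q] en; first by [].
    rewrite (_ : n - _ = q * m.+1 + m); last by move: en; rewrite mulSn; arith.
    by rewrite modnMDl modn_small //; arith.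
  by rewrite (_ : n - _ = q * m.+1 + 0) ?modnMDl ?mod0n //; arith.
apply: (concentrated_read_back downQ (b := b) _ fr) => [|a ha|].
- by arith.
- have e1 : (n - m + a).+1 = n - (m - a.+1) by arith.
  have e2 : n - m + a = n - (m - a.+1).+1 by arith.
  have hm : m - a.+1 < m by arith.
  rewrite set0U e1 e2 /b; move: (m - a.+1) hm => h hm {a ha e1 e2 fr b}.
  have cA : #|block (n - h) h| = h by rewrite card_block //; arith.
  have posE : pos (n - h.+1) = n - h.+1 :> nat by rewrite val_pos_small //; arith.
  have [q [r [rm en fn]]] := path_zerosP m (n - h.+1).
  apply: (@path_concentrated p m K Q downQ m_gt0 (n - h.+1) h 0) => //; try arith.
  + by rewrite subsetD1 subsetT pos_block; arith.
  + by apply/setP => i; rewrite !inE -val_eqE /= posE; have := ltn_ord i; arith.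
  + move=> X /andP[AX]; rewrite subsetD1 => /andP[_ zX].
    by rewrite /Q (cycle_norun_after _ hm) //; arith.
  + rewrite en modnMDl modn_small // => r0; rewrite cA r0 addn0 mulnK //.
    have nE : n = q * m.+1 + h.+1 by arith.
    have fE : f n = q.*2 + 1 by rewrite nE path_zerosE //; arith.
    have : q * m.+1 = q * m.-1 + q.*2 by rewrite -muln2 -mulnDr; congr (_ * _); arith.
    by rewrite fE; move: (q * m.-1) (q * m.+1) nE => t1 t2; arith.
  + rewrite en modnMDl modn_small // => r0; rewrite cA r0 divnMDl // divn_small; last by arith.
    have nE : n = q.+1 * m.+1 + 0 by rewrite mulSn; arith.
    have fE : f n = q.+1.*2 by rewrite nE path_zerosE // addn0.
    have : q * m.+1 = q * m.-1 + q.*2 by rewrite -muln2 -mulnDr; congr (_ * _); arith.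
    rewrite addn0 fE doubleS; rewrite mulSn in nE.
    by move: (q * m.-1) (q * m.+1) nE => t1 t2; arith.
apply: concentrated_empty => X; rewrite /node set0U; apply/negP => /andP[/andP[AX _]].
by apply/negP; rewrite negbK; apply/has_runP; exists (n - m); rewrite run_block //; arith.
Qed.

Lemma has_run_nonvanishing :
  nonvanishing K (@has_run p m) (n - f n).+1.
Proof.
have [_ /(_ isT) nv] := cycle_concentrated.
have := @nonvanishing_compl _ _ _ _ ord0 _ nv; move=> h.
apply: eq_nonvanishing (h _) => [X|X Y XY]; first by rewrite /= negbK.
by apply/contra/has_runS.
Qed.
End CycleCohomology.

(** * Squarefree monomial ideals *)

Section MonomialParts.
Local Open Scope ring_scope.
Variables (n : nat) (K : fieldType).
Local Notation S := {mpoly K[n]}.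
Implicit Types (f g : S) (u m : 'X_{1..n}) (X A B : {set 'I_n}).

Definition mfilter (a : pred 'X_{1..n}) f : S :=
  \sum_(u <- msupp f | a u) f@_u *: 'X_[u].

Lemma mcoeff_mfilter a f u : (mfilter a f)@_u = if a u then f@_u else 0.
Proof.
rewrite /mfilter raddf_sum /= big_mkcond /=.
have h v : (if a v then (f@_v *: 'X_[K, v])@_u else 0) =
    if v == u then (if a u then f@_u else 0) else 0.
  by rewrite mcoeffZ mcoeffX; case: eqVneq => [->|_]; rewrite ?mulr1 ?mulr0 ?if_same.
rewrite (eq_bigr _ (fun v _ => h v)) -big_mkcond /=.
have [uf|uf] := boolP (u \in msupp f).
  by rewrite -big_filter filter_pred1_uniq ?msupp_uniq // big_seq1.
rewrite big1_seq => [|v /andP[/eqP -> vf]]; last by rewrite vf in uf.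
by rewrite (memN_msupp_eq0 uf) if_same.
Qed.

Definition mquot m f : S := \sum_(u <- msupp f | (m <= u)%MM) f@_u *: 'X_[u - m].

Lemma mulX_mquot m f : 'X_[m] * mquot m f = mfilter (fun u => (m <= u)%MM) f.
Proof.
rewrite mulr_sumr; apply: eq_bigr => u mu.
by rewrite -scalerAr -mpolyXD addmC submK.
Qed.

Lemma mcoeffXM m f u : ('X_[m] * f)@_(m + u) = f@_u.
Proof. by rewrite mulrC mcoeffMX. Qed.

Lemma mcoeffXM_eq0 m f u : ~~ (m <= u)%MM -> ('X_[m] * f)@_u = 0.
Proof.
move=> mu; apply/eqP; rewrite -[_ == 0]negbK -mcoeff_msupp.
apply: contra mu => /msuppM_le/allpairsP[[v w] [/= vm _ ->]].
by move: vm; rewrite msuppX inE => /eqP ->; apply: lem_addr.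
Qed.

Lemma mcoeff_mquot m f u : (mquot m f)@_u = f@_(m + u).
Proof. by rewrite -(mcoeffXM m) mulX_mquot mcoeff_mfilter lem_addr. Qed.

Definition mnm_supp u : {set 'I_n} := [set i | (0 < u i)%N].

Lemma mnm_suppD u m : mnm_supp (u + m) = mnm_supp u :|: mnm_supp m.
Proof. by apply/setP => i; rewrite !inE mnmDE addn_gt0. Qed.

Lemma mnm_supp_mesym1 A : mnm_supp (mesym1 A) = A.
Proof. by apply/setP => i; rewrite inE mnmE lt0b. Qed.

Lemma mnm_supp1 i : mnm_supp U_(i) = [set i].
Proof. by rewrite -mesym1_set1 mnm_supp_mesym1. Qed.

Lemma mesym1_le A u : (mesym1 A <= u)%MM = (A \subset mnm_supp u).
Proof.
apply/mnm_lepP/subsetP => [h i iA|h i].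
  by rewrite inE; have := h i; rewrite mnmE iA.
by rewrite mnmE; case: (boolP (i \in A)) => // /h; rewrite inE.
Qed.

Lemma mesym1U1 i A : i \notin A -> mesym1 (i |: A) = (U_(i) + mesym1 A)%MM.
Proof.
move=> iA; apply/mnmP => j; rewrite mnmDE !mnmE in_setU1 eq_sym.
by case: eqVneq => // <-; rewrite (negbTE iA).
Qed.

Lemma mesym1D1 i A : i \in A -> mesym1 A = (U_(i) + mesym1 (A :\ i))%MM.
Proof. by move=> iA; rewrite -{1}(setD1K iA) mesym1U1 // !inE eqxx. Qed.

(** For an up-closed [P] this is the squarefree monomial ideal of [P]. *)
Definition mono_ideal (P : pred {set 'I_n}) f := forall u, f@_u != 0 -> P (mnm_supp u).

Lemma mono_ideal0 P : mono_ideal P 0.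
Proof. by move=> u; rewrite mcoeff0 eqxx. Qed.

Lemma mono_idealB P f g : mono_ideal P f -> mono_ideal P g -> mono_ideal P (f - g).
Proof.
move=> hf hg u; rewrite mcoeffB; have [->|/hf//] := eqVneq f@_u 0.
by rewrite sub0r oppr_eq0 => /hg.
Qed.

Lemma mono_idealN P f : mono_ideal P f -> mono_ideal P (- f).
Proof. by rewrite -[- f]sub0r; apply/mono_idealB/mono_ideal0. Qed.

Lemma mono_idealD P f g : mono_ideal P f -> mono_ideal P g -> mono_ideal P (f + g).
Proof. by move=> hf hg; rewrite -[g]opprK; apply/mono_idealB/mono_idealN. Qed.

Lemma mono_ideal_sum P (I : Type) (r : seq I) (Q : pred I) (F : I -> S) :
  (forall i, Q i -> mono_ideal P (F i)) -> mono_ideal P (\sum_(i <- r | Q i) F i).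
Proof.
by move=> h; apply: big_ind => //; [exact: mono_ideal0|exact: mono_idealD].
Qed.

Lemma mono_idealM (P : pred {set 'I_n}) f g : (forall X Y : {set 'I_n}, X \subset Y -> P X -> P Y) ->
  mono_ideal P f -> mono_ideal P (g * f).
Proof.
move=> up hf u; rewrite -mcoeff_msupp => /msuppM_le/allpairsP[[v w] [/= _ wf ->]].
rewrite mnm_suppD; apply: up (subsetUr _ _) _; apply: hf.
by rewrite -mcoeff_msupp.
Qed.

Section Generators.
Local Open Scope ring_scope.
Variables (r : nat) (w : 'I_r -> 'X_{1..n}).
Local Notation I := (ideal_gen (fun i => 'X_[K, w i])).

Lemma mem_mono_gen f :
  (forall u, f@_u != 0 -> exists i, (w i <= u)%MM) <-> f \in I.
Proof.
split=> [h|/ideal_genP[c ->] u].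
  rewrite [f]mpolyE big_seq; apply: rpred_sum => u.
  rewrite mcoeff_msupp => /h[i wu]; apply/ideal_genP.
  exists (fun j => if j == i then f@_u *: 'X_[u - w i] else 0).
  rewrite (bigD1 i) //= eqxx -scalerAl -mpolyXD submK // big1 ?addr0 // => j.
  move=> /negbTE ->.
  by rewrite mul0r.
rewrite raddf_sum /= => nz; apply/existsP; apply: contraNT nz => /existsPn nw.
by apply/eqP/big1 => i _; rewrite mulrC mcoeffXM_eq0.
Qed.
End Generators.
End MonomialParts.

(** * The cycle ideal in terms of runs *)

Section CycleIdeal.
Local Open Scope ring_scope.
Variables (p m : nat) (K : fieldType).
Local Notation n := p.+1.

Lemma iter_ordS k (i : 'I_n) : iter k (@ordS n) i = pos p (i + k).
Proof.
elim: k => [|k IH]; first by rewrite addn0 pos_val.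
by apply: val_inj; rewrite /= IH !val_pos addnS -addn1 modnDml addn1.
Qed.

(** As [m < n], the [m] positions are distinct and the exponent is squarefree. *)
Lemma cycle_path_exp_le (i : 'I_n) (u : 'X_{1..n}) : (m < n)%N ->
  (cycle_path_exp n m i <= u)%MM = run (mnm_supp u) i m.
Proof.
move=> mn; apply/mnm_lepP/runP => [h k hk|h j].
  rewrite inE; apply: leq_trans (h _); rewrite mnm_sumE.
  have km : (k - i < m)%N by arith.
  rewrite (bigD1 (Ordinal km)) //= iter_ordS mnm1E subnKC ?eqxx //.
  by case/andP: hk.
rewrite mnm_sumE.
have [jh|jh] := boolP [exists k : 'I_m, pos p (i + k) == j]; last first.
  rewrite big1 // => k _; rewrite mnm1E iter_ordS.
  by apply/eqP; rewrite eqb0; apply: contra jh => h'; apply/existsP; exists k.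
have [k /eqP kj] := existsP jh.
have : (0 < u j)%N by have := h (i + k)%N; rewrite kj inE; apply; have := ltn_ord k; arith.
apply: leq_trans; rewrite (bigD1 k) //= iter_ordS mnm1E kj eqxx.
rewrite big1 // => l; apply: contra_neq_eq; rewrite iter_ordS mnm1E => lj.
have /eqP : pos p (i + l) = pos p (i + k) by rewrite kj; move: lj; case: (_ =P j).
rewrite -val_eqE /= !val_pos eqn_modDl !modn_small; first by move/eqP/val_inj.
  by apply: ltn_trans mn.
by apply: ltn_trans mn.
Qed.

Lemma mem_cycle_ideal (f : {mpoly K[n]}) : (m < n)%N ->
  f \in ideal_gen (fun i => 'X_[K, cycle_path_exp n m i]) <->
  mono_ideal (has_run m) f.
Proof.
move=> mn; rewrite -mem_mono_gen; split=> h u /h => [[i]|/hasP[i]].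
  by rewrite cycle_path_exp_le // => ri; apply/has_runP; exists i.
rewrite mem_iota add0n => /andP[_ lti] ri; exists (Ordinal lti).
by rewrite cycle_path_exp_le.
Qed.
End CycleIdeal.

Section Natmax.
Local Open Scope ring_scope.
Lemma natmax_eq (P : nat -> Prop) d : P d -> (forall e, P e -> (e <= d)%N) -> natmax P = d.
Proof.
move=> Pd hd; rewrite /natmax; case: pselect => [ex|[]]; last by exists d.
case: (cid ex) => /= e [Pe he]; apply/eqP; rewrite eqn_leq.
by rewrite (hd _ Pe) (he _ Pd).
Qed.

(** The bound [b] ensures that the maximum exists, so that [natmax] is not the default 0. *)
Lemma natmax_ge (P : nat -> Prop) b d :
  P d -> (forall e, P e -> (e <= b)%N) -> (d <= natmax P)%N.
Proof.
move=> Pd hb; rewrite /natmax; case: pselect => [ex|[]].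
  by case: (cid ex) => /= e [Pe he]; apply: he.
have ex : exists e, `[< P e >] by exists d; apply/asboolP.
have ub e : `[< P e >] -> (e <= b)%N by move=> /asboolP/hb.
have [e /asboolP Pe he] := ex_maxnP ex ub.
by exists e; split=> // e' Pe'; apply/he/asboolP.
Qed.

Lemma natmax_le (P : nat -> Prop) b :
  (forall e, P e -> (e <= b)%N) -> (natmax P <= b)%N.
Proof.
move=> hb; rewrite /natmax; case: pselect => [ex|//].
by case: (cid ex) => /= e [Pe _]; apply: hb.
Qed.
End Natmax.

(** * Stanley depth from intervals and facets *)

Section Stanley.
Local Open Scope ring_scope.
Variables (n : nat) (K : fieldType).
Local Notation S := {mpoly K[n]}.
Implicit Types (f g : S) (u : 'X_{1..n}) (X A B : {set 'I_n}).
Variables (r : nat) (w : 'I_r -> 'X_{1..n}) (P : pred {set 'I_n}).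
Local Notation g := (fun i => 'X_[K, w i]).
Hypothesis memP : forall f, f \in ideal_gen g <-> mono_ideal P f.

Lemma val_ideal_scale f (y : ideal_mod g) : val (f *: y) = f * (val y : S) :> S.
Proof. by []. Qed.

Lemma stanley_min_le k (Z : 'I_k -> {set 'I_n}) : (stanley_min Z <= n)%N.
Proof.
rewrite /stanley_min; apply: (big_ind (fun x => x <= n)%N) => // [x y xn _|i _].
  by rewrite geq_min xn.
by rewrite -[X in (_ <= X)%N]card_ord max_card.
Qed.

(** The interval from A to B carries the summand x^A K[B], spanned by the monomials with support in
    the interval. So each monomial of the ideal lies in exactly one summand. *)
Lemma sdepth_ideal_ge z : interval_partition P z ->
  (n - z <= sdepth (ideal_grading K w))%N.
Proof.
move=> [l [hl cl]].
pose I (i : 'I_(size l)) := nth (set0, set0) l i.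
have Il i : I i \in l by apply: mem_nth.
have sumI X : (\sum_i interval (I i).1 (I i).2 X)%N = P X.
  by rewrite -cl -sum1_count (big_nth (set0, set0)) big_mkord [RHS]big_mkcond.
have I_uniq X i j : interval (I i).1 (I i).2 X -> interval (I j).1 (I j).2 X -> i = j.
  move=> hi hj; apply/eqP; apply: contraT => ij; have := sumI X.
  rewrite (bigD1 i) // (bigD1 j) 1?eq_sym //= hi hj.
  by case: (P X).
have I_sub i X : interval (I i).1 (I i).2 X -> P X.
  by move=> hi; have := sumI X; rewrite (bigD1 i) //= hi; case: (P X).
have I_ex X : P X -> exists i, interval (I i).1 (I i).2 X.
  move=> PX; apply/existsP; apply: contraT => /existsPn nI.
  by have := sumI X; rewrite PX big1 // => i _; rewrite (negbTE (nI i)).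
have Imin i : interval (I i).1 (I i).2 (I i).1.
  by have /andP[h _] := hl _ (Il i); rewrite /interval subxx.
pose a i u := interval (I i).1 (I i).2 (mnm_supp u).
have memX i : 'X_[K, mesym1 (I i).1] \in ideal_gen g.
  apply/memP => u; rewrite mcoeffX; have [<- _|_] := eqVneq (mesym1 (I i).1) u; last by rewrite eqxx.
  by rewrite mnm_supp_mesym1; apply: I_sub (Imin i).
pose x i : ideal_mod g := Sub ('X_[K, mesym1 (I i).1] : S^o) (memX i).
pose Z i := (I i).2.
have spaceP i (y : ideal_mod g) : stanley_space (x i) (Z i) y <->
    forall u, (val y : S)@_u != 0 -> a i u.
  split=> [[f fZ ->] u|hy].
    rewrite val_ideal_scale /= mulrC; have [le|nle] := boolP (mesym1 (I i).1 <= u)%MM; last first.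
      by rewrite mcoeffXM_eq0 // eqxx.
    rewrite -(submK le) addmC mcoeffXM => nz.
    have uZ := fZ _ (_ : (u - mesym1 (I i).1)%MM \in msupp f).
    rewrite /a mnm_suppD mnm_supp_mesym1 /interval subsetUl /= subUset.
    have /andP[-> _] := hl _ (Il i); apply/subsetP => j; rewrite inE => uj.
    by apply: contraTT uj => jZ; rewrite uZ // mcoeff_msupp.
  exists (mquot (mesym1 (I i).1) (val y : S)) => [u|].
    rewrite mcoeff_msupp mcoeff_mquot => /hy /andP[_ uB] j jZ.
    apply/eqP; rewrite -leqn0 leqNgt; apply: contra jZ => uj.
    by apply: (subsetP uB); rewrite inE mnmDE addn_gt0 uj orbT.
  apply: val_inj; rewrite val_ideal_scale /= [RHS]mulrC mulX_mquot.
  apply/mpolyP => u; rewrite mcoeff_mfilter mesym1_le.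
  case: ifP => // /negbT nA; apply/eqP; apply: contraNT nA => /hy.
  by case/andP.
have memF i (y : ideal_mod g) : mfilter (a i) (val y : S) \in ideal_gen g.
  apply/memP => u; rewrite mcoeff_mfilter; case: ifP => [/I_sub//|].
  by rewrite eqxx.
have dec : stanley_decomposition (ideal_grading K w) x Z.
  split.
  - move=> i; exists (mdegree (mesym1 (I i).1)); apply/mpoly_compP => u /=.
    by rewrite msuppX inE => /eqP ->.
  - move=> i u _ /(congr1 val) /eqP; rewrite val_ideal_scale /= mulf_eq0 => /orP[/eqP //|/eqP].
    move=> /(congr1 (mcoeff (mesym1 (I i).1))) /eqP.
    by rewrite mcoeffX eqxx mcoeff0 oner_eq0.
  - move=> y; exists [ffun i => Sub (mfilter (a i) (val y : S) : S^o) (memF i y)].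
    have vsum (v : {ffun 'I_(size l) -> ideal_mod g}) u :
        (val (\sum_i v i) : S)@_u = \sum_i (val (v i) : S)@_u.
      rewrite (raddf_sum (val : ideal_mod g -> S^o)) /=.
      exact: (raddf_sum (mcoeff u)).
    have yP u : (val y : S)@_u != 0 -> P (mnm_supp u).
      by move=> nz; have /memP h := valP y; apply: h.
    split; first split.
    + move=> i; apply/spaceP => u; rewrite ffunE /= mcoeff_mfilter.
      by case: ifP => //; rewrite eqxx.
    + apply: val_inj; apply/mpolyP => u; rewrite vsum.
      have [y0|/[dup] nz /yP/I_ex[i hi]] := eqVneq (val y : S)@_u 0.
        by rewrite y0 big1 // => i _; rewrite ffunE /= mcoeff_mfilter y0 if_same.
      rewrite (bigD1 i) //= ffunE /= mcoeff_mfilter /a hi big1 ?addr0 // => j ji.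
      rewrite ffunE /= mcoeff_mfilter /a; case: ifP => // hj.
      by rewrite (I_uniq _ _ _ hi hj) eqxx in ji.
    + move=> v [vs ye]; apply/ffunP => i; rewrite ffunE; apply: val_inj.
      apply/mpolyP => u /=; rewrite mcoeff_mfilter ye vsum; case: ifP => [hi|/negbT hi].
        rewrite (bigD1 i) //= big1 ?addr0 // => j ji.
        apply/eqP; apply: contraNT ji => nz; apply/eqP.
        by apply: I_uniq hi; have /spaceP := vs j; apply.
      apply/esym/eqP; apply: contraNT hi => nz.
      by have /spaceP := vs i; apply.
apply: (@leq_trans (stanley_min Z)).
  rewrite /stanley_min; apply: (big_ind (fun t => n - z <= t)%N) => [|s t hs ht|i _].
  - exact: leq_subr.
  - by rewrite leq_min hs.
  - have /andP[_ hz] := hl _ (Il i); rewrite leq_subLR addnC.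
    by rewrite -[X in (X <= _)%N]card_ord -(cardsC (Z i)) leq_add2l.
apply: (@natmax_ge _ n).
  by exists (size l), x, Z.
by move=> e [k [x' [Z' [_ <-]]]]; apply: stanley_min_le.
Qed.

(* The monomial of a facet [F] survives in the quotient but is killed by every
   variable outside [F], so only subsets of [F] can occur in the summand whose
   part in the degree of that monomial is nonzero. *)
Lemma sdepth_quot_le F : ~~ P F -> (forall j, j \notin F -> P (j |: F)) ->
  (sdepth (quot_grading K w) <= #|F|)%N.
Proof.
move=> nPF PF; apply: natmax_le => e [k [x [Z [[hom fr dec] <-]]]].
pose u := mesym1 F.
have [v [[vs ev] _]] := dec (quot_pi g 'X_[u]).
have fE i : exists fh : S * S, [/\ mpoly_on (Z i) fh.1, v i = fh.1 *: x i,
    x i = quot_pi g fh.2 & exists a, mpoly_comp a fh.2].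
  have [f fZ vE] := vs i; have [a [h ha xE]] := hom i.
  by exists (f, h); split=> //; exists a.
have {fE} [fh fhE] := fin_all_exists fE.
have nz : (\sum_i (fh i).1 * (fh i).2)@_u != 0.
  apply/negP => /eqP sum0; case/negP: nPF.
  rewrite -(mnm_supp_mesym1 F); apply: (_ : mono_ideal P ('X_[u] - \sum_i (fh i).1 * (fh i).2)).
    apply/memP/quot_piP; rewrite ev raddf_sum; apply: eq_bigr => i _.
    by have [_ -> -> _] := fhE i; rewrite -quot_piZ.
  by rewrite mcoeffB sum0 subr0 mcoeffX eqxx oner_eq0.
have [i nzi] : exists i, ((fh i).1 * (fh i).2)@_u != 0.
  apply/existsP; apply: contraNT nz => /existsPn h; rewrite raddf_sum /= big1 //.
  by move=> i _; apply/eqP; rewrite -[_ == _]negbK h.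
have [fZ _ xE [a /mpoly_compP ha]] := fhE i.
move: nzi; rewrite -mcoeff_msupp => /msuppM_le/allpairsP[[v1 v2] [/= v1f v2h uE]].
(* For [j] in [Z i] outside [F], x_j x^v1 would kill the generator: the generator is homogeneous of
   degree [v2], so the product has support [j |: F]. *)
have ZF : Z i \subset F.
  apply/subsetP => j jZ; apply: contraT => jF.
  have : 'X_[U_(j) + v1] = 0 :> S.
    apply: (fr i) => [t|].
      rewrite msuppX inE => /eqP -> i' i'Z; rewrite mnmDE (fZ _ v1f) // addn0 mnm1E.
      by apply/eqP; rewrite eqb0; apply: contraNneq i'Z => <-.
    rewrite xE -quot_piZ -(raddf0 (quot_pi g)); apply/quot_piP; rewrite subr0.
    apply/memP => t; rewrite -mcoeff_msupp => /msuppM_le/allpairsP[[t1 t2] [/=]].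
    rewrite msuppX inE => /eqP -> /ha t2h ->.
    have -> : t2 = v2 by apply: mdegree_inj; rewrite t2h ha.
    by rewrite -addmA -uE mnm_suppD mnm_supp_mesym1 mnm_supp1 PF.
  move/(congr1 (mcoeff (U_(j) + v1))) => /eqP.
  by rewrite mcoeffX eqxx mcoeff0 oner_eq0.
apply: leq_trans (subset_leq_card ZF); rewrite /stanley_min.
elim: (index_enum _) (mem_index_enum i) => // i0 s IH; rewrite inE big_cons geq_min.
by case/predU1P => [->|/IH ->]; rewrite ?leqnn ?orbT.
Qed.
End Stanley.

(** * Elementary symmetric polynomials as a regular sequence *)

Section SymmetricSequence.
Local Open Scope ring_scope.
Variables (n : nat) (K : fieldType).
Local Notation S := {mpoly K[n]}.
Implicit Types (f g : S) (u : 'X_{1..n}) (X Y A B : {set 'I_n}).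
Implicit Types (P : pred {set 'I_n}) (b : 'I_n).
Local Notation e j := (mesym n K j.+1).

(* [in_esym i P] is membership in (e_1, ..., e_i) + I, with I the squarefree
   monomial ideal of [P]; [link] and [del] below are (I : x_b) and (I, x_b). *)
Definition in_esym i P f := exists c : nat -> S, mono_ideal P (f - \sum_(j < i) e j * c j).

Definition esym_regular d P :=
  forall i, (i < d)%N -> forall f, in_esym i P (e i * f) -> in_esym i P f.

Definition upclosed P := forall X Y : {set 'I_n}, X \subset Y -> P X -> P Y.

Lemma in_esym_mono i P f : mono_ideal P f -> in_esym i P f.
Proof.
move=> hf; exists (fun=> 0); rewrite big1 ?subr0 // => j _; exact: mulr0.
Qed.

Lemma in_esymD i P f g : in_esym i P f -> in_esym i P g -> in_esym i P (f + g).
Proof.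
move=> [c hc] [c' hc']; exists (fun j => c j + c' j).
rewrite (eq_bigr (fun j : 'I_i => e j * c j + e j * c' j)); last first.
  by move=> j _; rewrite mulrDr.
by rewrite big_split opprD addrACA; apply: mono_idealD.
Qed.

Lemma in_esymM i P f g : upclosed P -> in_esym i P f -> in_esym i P (g * f).
Proof.
move=> up [c hc]; exists (fun j => g * c j).
rewrite (eq_bigr (fun j : 'I_i => g * (e j * c j))); last first.
  by move=> j _; rewrite mulrCA.
by rewrite -mulr_sumr -mulrBr; apply: mono_idealM.
Qed.

Lemma in_esymB i P f g : upclosed P -> in_esym i P f -> in_esym i P g ->
  in_esym i P (f - g).
Proof. by move=> up hf hg; rewrite -mulN1r; apply/in_esymD/in_esymM. Qed.

Lemma in_esymW i P (P' : pred {set 'I_n}) f : (forall X, P X -> P' X) ->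
  in_esym i P f -> in_esym i P' f.
Proof. by move=> PP' [c hc]; exists c => u /hc/PP'. Qed.

Lemma eq_esym_regular d P (P' : pred {set 'I_n}) :
  P =1 P' -> esym_regular d P -> esym_regular d P'.
Proof. by move=> /funext ->. Qed.

Lemma esym_regularW d d' P : (d' <= d)%N -> esym_regular d P -> esym_regular d' P.
Proof. by move=> dd h i id; apply: h; apply: leq_trans dd. Qed.

(* Vanishing of the first Koszul homology of a regular sequence. *)
Lemma esym_relation d P i (y : nat -> S) : upclosed P -> esym_regular d P ->
  (i <= d)%N -> mono_ideal P (\sum_(j < i) e j * y j) ->
  exists2 y' : nat -> S, forall j, mono_ideal P (y' j)
    & \sum_(j < i) e j * y j = \sum_(j < i) e j * y' j.
Proof.
move=> up reg; elim: i y => [|i IH] y id hy.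
  by exists (fun=> 0) => [j|]; [apply: mono_ideal0|rewrite !big_ord0].
have [|c hc] := reg i id (y i).
  exists (fun j => - y j).
  have -> // : e i * y i - \sum_(j < i) e j * - y j = \sum_(j < i.+1) e j * y j.
  rewrite big_ord_recr /= addrC -sumrN; congr (_ + _); apply: eq_bigr => j _.
  by rewrite mulrN opprK.
pose z := y i - \sum_(j < i) e j * c j.
have sumE : \sum_(j < i.+1) e j * y j = \sum_(j < i) e j * (y j + e i * c j) + e i * z.
  rewrite big_ord_recr /= /z mulrBr mulr_sumr.
  rewrite [in RHS](eq_bigr (fun j : 'I_i => e j * y j + e i * (e j * c j))) => [|j _].
    by rewrite big_split addrACA subrr addr0.
  by rewrite mulrDr mulrCA.
have [|y' y'P y'E] := IH (fun j => y j + e i * c j) (ltnW id).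
  have -> : \sum_(j < i) e j * (y j + e i * c j) = \sum_(j < i.+1) e j * y j - e i * z.
    by rewrite sumE addrK.
  by apply: mono_idealB => //; apply: mono_idealM.
exists (fun j => if (j < i)%N then y' j else z) => [j|]; first by case: ifP.
rewrite sumE y'E big_ord_recr /= ltnn; congr (_ + _).
by apply: eq_bigr => j _; rewrite ltn_ord.
Qed.

Definition link b P : pred {set 'I_n} := fun X => P (b |: X).
Definition del b P : pred {set 'I_n} := fun X => P X || (b \in X).

Lemma upclosed_link b P : upclosed P -> upclosed (link b P).
Proof. by move=> up X Y XY; apply: up; apply: setUS. Qed.

Lemma upclosed_del b P : upclosed P -> upclosed (del b P).
Proof.
move=> up X Y XY /orP[/(up _ _ XY) h|bX]; apply/orP; [by left|right].
exact: (subsetP XY).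
Qed.

Lemma U1_le b u : (U_(b) <= u)%MM = (b \in mnm_supp u).
Proof. by rewrite -mesym1_set1 mesym1_le sub1set. Qed.

Lemma mono_ideal_colon b P f : mono_ideal P ('X_b * f) <-> mono_ideal (link b P) f.
Proof.
split=> h u nz.
  by have := h (U_(b) + u)%MM; rewrite mcoeffXM mnm_suppD mnm_supp1; apply.
have [bu|bu] := boolP (U_(b) <= u)%MM; last by rewrite mcoeffXM_eq0 ?eqxx in nz.
rewrite -(submK bu) addmC in nz *; rewrite mcoeffXM in nz.
by have := h _ nz; rewrite /link mnm_suppD mnm_supp1.
Qed.

Lemma mono_ideal_del b P f : mono_ideal (del b P) f ->
  mono_ideal P (f - 'X_b * mquot U_(b) f).
Proof.
move=> h u; rewrite mulX_mquot mcoeffB mcoeff_mfilter U1_le.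
case: ifP => bu; first by rewrite subrr eqxx.
by rewrite subr0 => /h; rewrite /del bu orbF.
Qed.

Lemma mono_ideal_delX b P f : mono_ideal (del b P) ('X_b * f).
Proof. by apply/mono_ideal_colon => u _; rewrite /link /del setU11 orbT. Qed.

Lemma mul_sum_mquot b i (y : nat -> S) :
  'X_b * (\sum_(j < i) e j * mquot U_(b) (y j)) =
  \sum_(j < i) e j * y j - \sum_(j < i) e j * (y j - 'X_b * mquot U_(b) (y j)).
Proof.
rewrite -sumrB mulr_sumr; apply: eq_bigr => j _.
by rewrite -mulrBr subKr mulrCA.
Qed.

(** Modulo (e_1, ..., e_i) + I, [f] is a multiple x_b v. By [esym_relation] over (I, x_b), the
    coefficients expressing x_b e_i v can be divided by x_b up to I, which leaves a relation over (I
    : x_b). *)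
Lemma esym_regular_split d b P : upclosed P -> esym_regular d (link b P) ->
  esym_regular d (del b P) -> esym_regular d P.
Proof.
move=> up rl rd i id f hf.
have PD X : P X -> del b P X by rewrite /del => ->.
have updel := @upclosed_del b _ up; have uplink := @upclosed_link b _ up.
have [c hc] := rd i id f (in_esymW PD hf).
pose v := mquot U_(b) (f - \sum_(j < i) e j * c j).
have fE : in_esym i P (f - 'X_b * v).
  by exists c; rewrite addrAC; apply: mono_ideal_del.
suff [c' hc'] : in_esym i P ('X_b * v).
  by rewrite -[f](subrK ('X_b * v)); apply: in_esymD => //; exists c'.
have [y hy] : in_esym i P ('X_b * (e i * v)).
  have -> : 'X_b * (e i * v) = e i * f - e i * (f - 'X_b * v).
    by rewrite mulrBr subKr mulrCA.
  by apply: in_esymB => //; apply: in_esymM.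
have [|y' y'P y'E] := esym_relation updel rd (ltnW id) (y := y).
  rewrite -[X in mono_ideal _ X](subKr ('X_b * (e i * v))).
  by apply: mono_idealB; [exact: mono_ideal_delX|move=> u /hy/PD].
have [c' hc'] : in_esym i (link b P) v.
  apply: rl => //; exists (fun j => mquot U_(b) (y' j)); apply/mono_ideal_colon.
  have -> : 'X_b * (e i * v - \sum_(j < i) e j * mquot U_(b) (y' j)) =
      ('X_b * (e i * v) - \sum_(j < i) e j * y j) +
      \sum_(j < i) e j * (y' j - 'X_b * mquot U_(b) (y' j)).
    by rewrite y'E mulrBr mul_sum_mquot opprB addrA addrAC.
  apply: mono_idealD => //; apply: mono_ideal_sum => j _.
  by apply: mono_idealM => //; apply: mono_ideal_del.
exists (fun j => 'X_b * c' j).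
rewrite (eq_bigr (fun j : 'I_i => 'X_b * (e j * c' j))) => [|j _]; last by rewrite mulrCA.
by rewrite -mulr_sumr -mulrBr; apply/mono_ideal_colon.
Qed.

(** An instance of permuting a regular sequence: x_b is regular on S/I as (I : x_b) = I, and
    [esym_relation] over (I, x_b) divides the coefficients by x_b. *)
Lemma var_regular d b P i f : upclosed P -> link b P =1 P ->
  esym_regular d (del b P) -> (i <= d)%N ->
  in_esym i P ('X_b * f) -> in_esym i P f.
Proof.
move=> up lk rd id [c hc]; have updel := @upclosed_del b _ up.
have PD X : P X -> del b P X by rewrite /del => ->.
have [|y yP yE] := esym_relation updel rd id (y := c).
  rewrite -[X in mono_ideal _ X](subKr ('X_b * f)).
  by apply: mono_idealB; [exact: mono_ideal_delX|move=> u /hc/PD].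
exists (fun j => mquot U_(b) (y j)).
suff /mono_ideal_colon h : mono_ideal P ('X_b * (f - \sum_(j < i) e j * mquot U_(b) (y j))).
  by move=> u /h; rewrite lk.
have -> : 'X_b * (f - \sum_(j < i) e j * mquot U_(b) (y j)) =
    ('X_b * f - \sum_(j < i) e j * c j) +
    \sum_(j < i) e j * (y j - 'X_b * mquot U_(b) (y j)).
  by rewrite yE mulrBr mul_sum_mquot opprB addrA addrAC.
apply: mono_idealD => //; apply: mono_ideal_sum => j _.
by apply: mono_idealM => //; apply: mono_ideal_del.
Qed.

Definition mtrunc t f := mfilter (fun u => mdeg u < t)%N f.

Lemma mtrunc_mesym t j f : mtrunc t (mesym n K j * f) = mesym n K j * mtrunc (t - j) f.
Proof.
apply/mpolyP => u; rewrite mcoeff_mfilter mesymE !mulr_suml !raddf_sum /=.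
case: ifP => [ut|/negbT ut].
  apply: eq_bigr => h /eqP hj; have [le|nle] := boolP (mesym1 h <= u)%MM.
    rewrite -(submK le) addmC !mcoeffXM mcoeff_mfilter; case: ifP => //.
    by rewrite -{}(submK le) mdegD mdeg_mesym1 hj in ut; move/negP; case; arith.
  by rewrite !mcoeffXM_eq0.
rewrite big1 // => h /eqP hj; have [le|nle] := boolP (mesym1 h <= u)%MM.
  rewrite -(submK le) addmC mcoeffXM mcoeff_mfilter; case: ifP => // lt.
  by rewrite -(submK le) mdegD mdeg_mesym1 hj in ut; case/negP: ut; arith.
by rewrite mcoeffXM_eq0.
Qed.

(* Modulo e_1, ..., e_i every such [f] is a multiple of every power of the
   variable, and these ideals are homogeneous. *)
Lemma esym_regular_cone d b P : upclosed P -> link b P =1 P ->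
  esym_regular d (del b P) -> esym_regular d P.
Proof.
move=> up lk rd i id f hf; have updel := @upclosed_del b _ up.
have PD X : P X -> del b P X by rewrite /del => ->.
have claim t : exists v, in_esym i P (f - 'X_b ^+ t * v) /\ in_esym i P (e i * v).
  elim: t => [|t [v [fv ev]]].
    exists f; split=> //; rewrite expr0 mul1r subrr; apply: in_esym_mono.
    exact: mono_ideal0.
  have [c hc] := rd i id v (in_esymW PD ev).
  pose v' := mquot U_(b) (v - \sum_(j < i) e j * c j).
  have vv' : in_esym i P (v - 'X_b * v').
    by exists c; rewrite addrAC; apply: mono_ideal_del.
  exists v'; split.
    rewrite (_ : f - _ = (f - 'X_b ^+ t * v) + 'X_b ^+ t * (v - 'X_b * v')).
      by apply: in_esymD => //; apply: in_esymM.
    by rewrite mulrBr addrA subrK exprSr mulrA.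
  apply: (var_regular up lk rd (ltnW id)).
  rewrite mulrCA -[_ * (_ * v')](subKr (e i * v)) -mulrBr.
  by apply: in_esymB => //; apply: in_esymM.
(* The power of the variable exceeds the degree of [f], so truncation removes its multiple and
   leaves [f]. *)
have [v [[c hc] _]] := claim (msize f).
exists (fun j => mtrunc (msize f - j.+1) (c j)).
rewrite (eq_bigr (fun j : 'I_i => mtrunc (msize f) (e j * c j))); last first.
  by move=> j _; rewrite mtrunc_mesym.
move=> u; rewrite mcoeffB raddf_sum /=.
rewrite (eq_bigr (fun j : 'I_i => if (mdeg u < msize f)%N then (e j * c j)@_u else 0));
  last by move=> j _; rewrite mcoeff_mfilter.
have [ut|ut] := ltnP (mdeg u) (msize f).
  have /= := hc u; rewrite !mcoeffB raddf_sum /= mpolyXn mcoeffXM_eq0 ?subr0 //.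
  apply/mnm_lepP => /(_ b); rewrite mulmnE mnm1E eqxx mul1n leqNgt => /negP; apply.
  by apply: leq_ltn_trans ut; rewrite mdegE (bigD1 b) //= leq_addr.
rewrite big1 // subr0 -mcoeff_msupp => /msize_mdeg_lt.
by rewrite ltnNge ut.
Qed.

(** Its monomial ideal is generated by the variables outside [B]. *)
Definition outside B : pred {set 'I_n} := fun X => ~~ (X \subset B).

Lemma upclosed_outside B : upclosed (outside B).
Proof. by move=> X Y XY; apply: contra; apply: subset_trans. Qed.

Lemma link_outside b B : b \in B -> link b (outside B) =1 outside B.
Proof. by move=> bB X; rewrite /link /outside subUset sub1set bB. Qed.

Lemma del_outside b B : del b (outside B) =1 outside (B :\ b).
Proof. by move=> X; rewrite /del /outside subsetD1 negb_and negbK. Qed.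

(* Modulo e_1, ..., e_{N-1} all variables are regular, hence so is their
   product e_N. *)
Lemma esym_regular_outside B : esym_regular #|B| (outside B).
Proof.
have [N] := ubnP #|B|; elim: N B => // N IH B BN i iB f hf.
have up := @upclosed_outside B.
have rd b : b \in B -> esym_regular #|B|.-1 (del b (outside B)).
  move=> bB; apply: (eq_esym_regular (fsym (del_outside b B))).
  rewrite (cardsD1 b) bB /=; apply: IH.
  by move: BN; rewrite (cardsD1 b) bB.
have [b bB] : exists b, b \in B by apply/set0Pn; rewrite -card_gt0 (leq_trans _ iB).
have [lt|ge] := ltnP i #|B|.-1.
  by apply: (esym_regular_cone up (link_outside bB) (rd b bB) lt).
have iE : i = #|B|.-1 by apply/eqP; rewrite eqn_leq ge -ltnS (leq_trans iB) // leqSpred.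
(* Here [i.+1 = #|B|], so the product over [B] is the only term of the symmetric polynomial that
   survives. *)
have prod : in_esym i (outside B) ('X_[mesym1 B] * f).
  have cB : i.+1 = #|B| by rewrite iE prednK // (leq_trans _ iB).
  rewrite -[X in in_esym _ _ X](subKr (e i * f)); apply: in_esymB => //.
  apply: in_esym_mono; rewrite mesymE (bigD1 B) ?cB //= -mulrBl addrAC subrr add0r.
  rewrite mulr_suml; apply: mono_ideal_sum => h /andP[/eqP hB nB].
  rewrite mulrC; apply: mono_idealM => // u; rewrite mcoeffX.
  case: (eqVneq (mesym1 h) u) => [<- _|_]; last by rewrite eqxx.
  rewrite mnm_supp_mesym1; apply: contra nB => hsub.
  by rewrite eqEcard hsub hB leqnn.
suff : forall C : {set 'I_n}, C \subset B -> in_esym i (outside B) ('X_[mesym1 C] * f) ->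
    in_esym i (outside B) f.
  by move/(_ B (subxx _) prod).
move=> C; have [k] := ubnP #|C|; elim: k C => // k IHk C Ck CB hC.
  have [C0|[c cC]] := set_0Vmem C; first by rewrite C0 mesym1_set0 mpolyX0 mul1r in hC.
  apply: (IHk (C :\ c)).
  - by move: Ck; rewrite (cardsD1 c) cC.
  - by rewrite (subset_trans (subD1set _ _)).
  have cB := subsetP CB _ cC.
  apply: (var_regular up (link_outside cB) (rd c cB)); first by rewrite iE.
  by rewrite mulrA -mpolyXD -mesym1D1.
Qed.

(** The node [(A, B)] stands for (I : x^A) + (x_i, i outside B), with I the ideal of the complement
    of [Q]. A split is a pair of [link] and [del], a leaf is generated by variables and leaves at
    least [n - z] others, a dead node is the unit ideal. *)
Lemma dtree_esym_regular (Q : pred {set 'I_n}) z A B :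
  (forall X Y : {set 'I_n}, X \subset Y -> Q Y -> Q X) ->
  dtree Q z A B -> A \subset B ->
  esym_regular (n - z) (fun X => ~~ ((X \subset B) && Q (X :|: A))).
Proof.
move=> down.
have up A' B' : upclosed (fun X => ~~ ((X \subset B') && Q (X :|: A'))).
  move=> X Y XY; apply: contra => /andP[YB QY].
  by rewrite (subset_trans XY) //=; apply: down QY; apply: setSU.
elim=> {A B} [A B _ hQ hz AB|A B hQ AB|k A B kA kB _ IH1 _ IH2 AB].
- apply: (@eq_esym_regular _ (outside B)) => [X|].
    rewrite /outside; have [XB|//] := boolP (X \subset B).
    by rewrite hQ ?subsetUr // subUset XB.
  apply: esym_regularW (esym_regular_outside (B := B)).
  by rewrite leq_subLR addnC -[X in (X <= _)%N]card_ord -(cardsC B) leq_add2l.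
- move=> i _ f _; apply: in_esym_mono => u _; apply/negP => /andP[XB].
  by apply/negP/hQ; rewrite ?subsetUr // subUset XB.
- have kAB : k |: A \subset B by rewrite subUset sub1set kB.
  have ABk : A \subset B :\ k by rewrite subsetD1 AB.
  apply: (@esym_regular_split _ k) => //.
    apply: eq_esym_regular (IH1 kAB) => X; rewrite /link subUset sub1set kB /=.
    by congr (~~ (_ && Q _)); rewrite setUCA setUA.
  apply: eq_esym_regular (IH2 ABk) => X; rewrite /del subsetD1.
  by rewrite -andbA [(k \notin X) && _]andbC andbA negb_and negbK.
Qed.
End SymmetricSequence.

(** * The ideal of the cycle *)

Section CycleDepth.
Local Open Scope ring_scope.
Variables (p m : nat) (K : fieldType).
Local Notation n := p.+1.
Local Notation f := (path_zeros m).
Local Notation S := {mpoly K[n]}.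
Local Notation g := (fun i => 'X_[K, cycle_path_exp n m i]).
Local Notation J := (ideal_mod g).
Local Notation e j := (mesym n K j.+1).
Hypothesis m_gt0 : (0 < m)%N.
Hypothesis m_lt_n : (m < n)%N.

Lemma val_ideal_sum (I : Type) (r : seq I) (P : pred I) (F : I -> J) :
  val (\sum_(i <- r | P i) F i) = \sum_(i <- r | P i) (val (F i) : S) :> S.
Proof. exact: (raddf_sum (val : J -> S^o)). Qed.

Lemma mono_val (x : J) : mono_ideal (has_run m) (val x : S).
Proof. exact: (@mem_cycle_ideal p m K _ m_lt_n).1 (valP x). Qed.

Lemma mono_lift (h : S) : mono_ideal (has_run m) h -> exists x : J, val x = h.
Proof.
by move=> hm; exists (Sub (h : S^o) ((@mem_cycle_ideal p m K h m_lt_n).2 hm)).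
Qed.

Lemma has_run_mdeg (u : 'X_{1..n}) : has_run m (mnm_supp u) -> (m <= mdeg u)%N.
Proof.
case/hasP => j; rewrite mem_iota add0n => /andP[_ jn] rj.
have le : (cycle_path_exp n m (Ordinal jn) <= u)%MM by rewrite cycle_path_exp_le.
rewrite -(submK le) mdegD mdeg_sum (eq_bigr (fun=> 1%N)) => [|k _]; last exact: mdeg1.
by rewrite sum_nat_const card_ord muln1 leq_addl.
Qed.

Lemma mesym_max_ideal j : e j \in max_ideal n K.
Proof.
apply/(mem_mono_gen (fun i : 'I_n => U_(i)%MM)) => u; rewrite -mcoeff_msupp.
rewrite msupp_mesymP => /existsP[h /andP[/eqP hj /eqP ->]].
have /set0Pn[i ih] : h != set0 by rewrite -card_gt0 hj.
by exists i; rewrite U1_le mnm_supp_mesym1.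
Qed.

Lemma seq_submod_esym i (x : J) : seq_submod (mkseq (fun j => e j) i) x <->
  exists2 y : nat -> S, forall j, mono_ideal (has_run m) (y j)
    & val x = \sum_(j < i) e j * y j :> S.
Proof.
split=> [[y ->]|[y yJ xE]].
  exists (fun j => val (y j)) => [j|]; first exact: mono_val.
  rewrite val_ideal_sum size_mkseq; apply: eq_bigr => j _.
  by rewrite val_ideal_scale nth_mkseq.
have [y' y'E] := choice (fun j => mono_lift (yJ j)).
exists y'; apply: val_inj; rewrite /= xE [RHS]val_ideal_sum size_mkseq.
by apply: eq_bigr => j _; rewrite val_ideal_scale nth_mkseq // y'E.
Qed.

Lemma upclosed_has_run : upclosed (@has_run p m).
Proof. by move=> X Y; apply: has_runS. Qed.

Lemma has_run_esym_regular : esym_regular K (n - f n) (@has_run p m).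
Proof.
have down (X Y : {set 'I_n}) : X \subset Y -> ~~ has_run m Y -> ~~ has_run m X.
  by move=> XY; apply/contra/has_runS.
have := dtree_esym_regular (K := K) down (cycle_dtree m_lt_n m_gt0) (sub0set _).
by apply: eq_esym_regular => X; rewrite subsetT /= setU0 negbK.
Qed.

(** An element of J that becomes, after multiplication, a combination of earlier e_j is one itself
    over S, where the e_j are regular; [esym_relation] then moves the coefficients into J. That
    relation uses regularity on S/J of the earlier elements only, whence one element is gained. *)
Lemma depth_ideal_ge : exists s : seq S,
  [/\ size s = (n - f n).+1, {subset s <= max_ideal n K} & regular_seq J s].
Proof.
pose s := mkseq (fun j => e j) (n - f n).+1.
have fn0 : (0 < f n)%N by apply: path_zeros_gt0.
have takes i : (i < size s)%N -> take i s = mkseq (fun j => e j) i.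
  rewrite size_mkseq => ilt; rewrite -map_take take_iota.
  by rewrite (minn_idPl _) // ltnW.
exists s; split; first by rewrite size_mkseq.
  by move=> x /mapP[j _ ->]; apply: mesym_max_ideal.
split=> [i ilt x|].
  rewrite takes // => /seq_submod_esym[y yJ xE]; apply/seq_submod_esym.
  have ilt' : (i <= n - f n)%N by move: ilt; rewrite size_mkseq.
  have [||c hc] := @esym_regular_outside n K setT i _ (val x).
  - by rewrite cardsT card_ord; arith.
  - exists y; rewrite -xE val_ideal_scale nth_mkseq // subrr.
    exact: mono_ideal0.
  have {hc} hc : val x = \sum_(j < i) e j * c j :> S.
    apply/eqP; rewrite -subr_eq0; apply/eqP/mpolyP => u; rewrite mcoeff0.
    by apply/eqP; apply: contraT => /hc; rewrite /outside subsetT.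
  have [|y' y'J y'E] := esym_relation upclosed_has_run has_run_esym_regular ilt' (y := c).
    by rewrite -hc; apply: mono_val.
  by exists y' => //; rewrite hc.
(* This generator has degree [m], the least in J, and every e_j has positive degree. *)
pose u0 := cycle_path_exp n m ord0.
have [x xE] : exists x : J, val x = 'X_[u0] :> S.
  apply: mono_lift => u; rewrite mcoeffX; case: (eqVneq u0 u) => [<- _|_].
    by apply/has_runP; exists 0%N; rewrite -(cycle_path_exp_le ord0 u0 m_lt_n) lepm_refl.
  by rewrite eqxx.
exists x => /seq_submod_esym[y yJ]; rewrite xE => /(congr1 (mcoeff u0)).
rewrite mcoeffX eqxx raddf_sum /= big1 => [|j _]; first by move/eqP; rewrite oner_eq0.
apply/eqP; rewrite -[_ == 0]negbK -mcoeff_msupp; apply/negP.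
move=> /msuppM_le/allpairsP[[v w] [/= ve wy uE]].
have : mdeg u0 = m.
  rewrite mdeg_sum (eq_bigr (fun=> 1%N)) => [|k _]; last exact: mdeg1.
  by rewrite sum_nat_const card_ord muln1.
rewrite uE mdegD; move: ve; rewrite msupp_mesymP => /existsP[h /andP[/eqP hj /eqP ->]].
rewrite mdeg_mesym1 hj; have := has_run_mdeg (yJ j w _); rewrite -mcoeff_msupp.
by move=> /(_ wy); arith.
Qed.

(** The values [c A] x^A turn the simplicial cocycle into a Koszul cocycle. Conversely, reading off
    the coefficient of x^A in a Koszul primitive at [A] yields a primitive of [c]. *)
Lemma depth_ideal_le (s : seq S) : {subset s <= max_ideal n K} ->
  regular_seq J s -> (size s <= (n - f n).+1)%N.
Proof.
have [c [cs cz] cnb] := has_run_nonvanishing K m_gt0 m_lt_n.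
have cJ A : exists x : J, val x = c A *: 'X_[mesym1 A] :> S.
  apply: mono_lift => u; rewrite mcoeffZ mcoeffX.
  case: (eqVneq (mesym1 A) u) => [<-|_]; last by rewrite mulr0 eqxx.
  by rewrite mulr1 mnm_supp_mesym1 => /cs[].
have [z zE] := fin_all_exists cJ.
have diffE (y : {set 'I_n} -> J) Y : val (kdiff (fun i : 'I_n => 'X_i) y Y) =
    \sum_(i in Y) ksign K i Y *: ('X_i * (val (y (Y :\ i)) : S)) :> S.
  rewrite val_ideal_sum; apply: eq_bigr => i _; rewrite val_ideal_scale.
  by rewrite -mulrA /ksign -mul_mpolyC rmorphXn rmorphN1.
move=> sI sr.
apply: (regular_seq_le_koszul (x := fun i : 'I_n => 'X_i : S) (z := z) sI sr) => [A|Y|[y hy]].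
- move=> An; apply: val_inj; rewrite zE raddf0; have [->|/cs[_ /eqP]] := eqVneq (c A) 0.
    by rewrite scale0r.
  by rewrite (negbTE An).
- apply: val_inj; rewrite diffE raddf0.
  rewrite (eq_bigr (fun i => (ksign K i Y * c (Y :\ i)) *: 'X_[mesym1 Y])); last first.
    move=> i iY; rewrite zE -scalerAr scalerA -mpolyXD -mesym1D1 //.
  rewrite -scaler_suml.
  have -> : \sum_(i in Y) ksign K i Y * c (Y :\ i) = kdiff (M := K^o) (fun=> 1) c Y.
    by apply: eq_bigr => i _; rewrite mulr1.
  have [PY|PY] := boolP (has_run m Y); first by rewrite cz // scale0r.
  rewrite diff0 ?scale0r // => i iY; apply/eqP; apply: contraNT PY => /cs[h _].
  by apply: has_runS h; rewrite subD1set.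
- apply: cnb; pose b A : K^o := (val (y A) : S)@_(mesym1 A).
  apply: (coboundary_ungraded (b := b)) => // [A|Y _].
    by move/mono_val; rewrite mnm_supp_mesym1.
  have /(congr1 (fun x : J => (val x : S)@_(mesym1 Y))) := hy Y.
  rewrite zE diffE mcoeffZ mcoeffX eqxx mulr1 => ->.
  rewrite raddf_sum /=; apply: eq_bigr => i iY.
  by rewrite mcoeffZ (mesym1D1 iY) mcoeffXM mulr1.
Qed.

Lemma depth_cycle_ideal : depth J (max_ideal n K) = (n - f n).+1.
Proof.
have [s [ss sI sr]] := depth_ideal_ge; apply: natmax_eq; first by exists s.
by move=> k [t [<- tI tr]]; apply: depth_ideal_le.
Qed.
End CycleDepth.

(** * Comparison of the bounds in terms of [phi] *)

Lemma phiE (N m : nat) : phi N m = N.+1 - path_zeros m N.+1.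
Proof.
rewrite /phi !addn1 /path_zeros lt0n -subnDA addnA addnn; congr (_ - (_ + _)).
Qed.

Theorem proposition4p1 (K : fieldType) (n m : nat) (hm : 2 <= m) (hn : m < n) :
  let sdepth_J := sdepth (ideal_grading K (cycle_path_exp n m)) in
  let sdepth_SJ := sdepth (quot_grading K (cycle_path_exp n m)) in
  let depth_J :=
    depth (ideal_mod (fun i : 'I_n => 'X_[K, cycle_path_exp n m i]))
      (max_ideal n K) in
  [/\ sdepth_J >= minn (phi (n - 1) m + m - 1) (phi n m + 1),
      sdepth_J >= depth_J /\ depth_J = phi (n - 1) m + 1
    & 3 <= m -> sdepth_J >= phi n m + 1 /\ sdepth_J >= sdepth_SJ + 1].
Proof.
case: n hn => // p hn sdepth_J sdepth_SJ depth_J.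
have m0 : 0 < m := ltnW hm.
have memJ f := @mem_cycle_ideal p m K f hn.
have fn0 : 0 < path_zeros m (p.+1 - m) by apply: path_zeros_gt0; lia.
have fE : path_zeros m (p.+1 - m) + 2 = path_zeros m p.+2 := path_zeros_cycle hn m0.
have fS := path_zerosS p.+1 m0; have fle := path_zeros_le p.+2 m0.
have sJ : phi p.+1 m + 1 <= sdepth_J.
  apply: leq_trans (sdepth_ideal_ge memJ (has_run_partition hn m0)).
  by rewrite phiE ?subn1; lia.
have dJ : depth_J = phi (p.+1 - 1) m + 1.
  by rewrite /depth_J depth_cycle_ideal // subn1 phiE addn1.
have sSJ : sdepth_SJ <= phi p.+1 m.
  have [F [nF F1 Fc]] := cycle_facet m0 hn.
  by apply: leq_trans (sdepth_quot_le memJ nF F1) _; rewrite phiE.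
have phile : phi (p.+1 - 1) m <= phi p.+1 m.
  by rewrite subn1 !phiE /=; lia.
split; last by lia.
  (* The second argument of the minimum alone is already a lower bound. *)
  by rewrite geq_min sJ orbT.
by split=> //; rewrite dJ; lia.
Qed.
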